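(* Consider an adaptive step up test with critical values $\hat\alpha_{i:n}=\left(\frac{i}{\hat n_0}\alpha_0\right)\wedge\lambda$, $i=1,\dots,n$, where $0<\alpha_0<\lambda<1$ and $\hat n_0=\hat n_0((\hat F_n(t))_{t\ge\lambda})>0$ is a strictly positive measurable function of $(\hat F_n(t))_{t\ge\lambda}$. (a) Suppose that $FDR=E(N_0)\,c$ holds for some constant $0<c<\frac1n$ for all distributions of the Basic Independence Model which satisfy (C1) and (C2). Then the critical values have already the form $$\hat\alpha_{i:n}=\frac{i}{n}\alpha\quad\text{almost surely, for } i=1,\dots,n,$$ where $\alpha=nc$. (b) Suppose that $FDR=E(N_0)\,c$ holds for some constant $0<c<\frac1n$ for all distributions of the Basic Independence Model with fixed $N_0=1$ and (C1). Then again $\hat\alpha_{i:n}=\frac{i}{n}\alpha$ almost surely for $i=1,\dots,n$, where $\alpha=nc$.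
   Context: Basic Independence (BI) Model: $n\ge 1$ null hypotheses $\mathcal H_1,\dots,\mathcal H_n$; $(H_i,\xi_i)_{i\le n}$ is an arbitrary random vector with values in $(\{0,1\}\times[0,1])^n$; $U_1,\dots,U_n$ are independent, uniformly distributed on $(0,1)$, and independent of $(H_i,\xi_i)_{i\le n}$. $\mathcal H_i$ is true if $H_i=0$ and false if $H_i=1$. The $p$-values are $p_i=(1-H_i)U_i+H_i\xi_i$. Put $N_0=\sum_{i=1}^n(1-H_i)$ and assume $E(N_0)>0$. Let $\hat F_n(t)=\frac1n\sum_{i=1}^n 1\{p_i\le t\}$, $t\in[0,1]$, and let $p_{1:n}\le\dots\le p_{n:n}$ be the order statistics of the $p$-values. Notation: $a\wedge b=\min(a,b)$, $a\vee b=\max(a,b)$. Adaptive step up (SU) test with data dependent critical values $0=\hat\alpha_{0:n}<\hat\alpha_{1:n}\le\dots\le\hat\alpha_{n:n}<1$: with $R=\max\{i: p_{i:n}\le\hat\alpha_{i:n}\}$ ($\max\emptyset=0$), it rejects all null hypotheses whose $p$-value is $\le\hat\alpha_{R:n}$; $R$ is the number of rejections. With $V=\sum_{i=1}^n 1\{p_i\le\hat\alpha_{R:n},H_i=0\}$, $FDR=E\left(\frac{V}{R\vee 1}\right)$. Conditions: (C1) The possible false $p$-values $\xi_1,\dots,\xi_n$ are i.i.d. according to an unknown distribution function $F_1$ with Lebesgue density, and $\xi_1$ is stochastically smaller than a uniformly distributed $p$-value on the unit interval, i.e. $F_1(t)\ge t$ for $0\le t\le1$. ($F_1$ ranges over all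 such distribution functions.) (C2) The random variables $H_1,\dots,H_n$ are i.i.d. Bernoulli variables and independent of $(\xi_i)_{i\le n}$, and the range of the probabilities $P(H_1=0)$ over the considered class of distributions covers an interval $I\subset(0,1)$ with non-empty interior. Under (C1) and (C2) the $p$-values $p_1,\dots,p_n$ are i.i.d. with distribution function $F(t)=P(H_1=0)\,t+P(H_1=1)F_1(t)$, $t\in[0,1]$ (Efron's two groups mixture model).
   Formalization: The equality of critical values is claimed a.s. only outside two events where it can fail: no p-value is ≤ λ; or all p-values are ≤ λ, α = λ and i < n. There the critical values do not affect the rejections, so the FDR condition does not determine them. *)

(* Defs.v *)
From HB Require Import structures.
From mathcomp Require Import all_boot all_order all_algebra.
From mathcomp Require Import all_classical all_reals all_analysis.

Set Implicit Arguments.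
Unset Strict Implicit.
Unset Printing Implicit Defensive.

Import Order.TTheory GRing.Theory Num.Theory.
Import numFieldNormedType.Exports.

Local Open Scope classical_set_scope.
Local Open Scope ring_scope.

Section Independence.
Context {d : measure_display} {T : measurableType d} {R : realType}.
Variable P : probability T R.

Definition mutually_independent {d' : measure_display}
    {T' : measurableType d'} {n : nat} (X : 'I_n -> T -> T') : Prop :=
  forall (J : {set 'I_n}) (A : 'I_n -> set T'),
    (forall i, measurable (A i)) ->
    P (\bigcap_(i in [set` J]) X i @^-1` A i) =
    (\prod_(i in J) P (X i @^-1` A i))%E.

Definition independent_pair {d1 d2 : measure_display}
    {T1 : measurableType d1} {T2 : measurableType d2}
    (X : T -> T1) (Y : T -> T2) : Prop :=
  forall (A : set T1) (B : set T2), measurable A -> measurable B ->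
    P (X @^-1` A `&` Y @^-1` B) = (P (X @^-1` A) * P (Y @^-1` B))%E.

End Independence.

(* A realization of the Basic Independence Model on some probability space;
   [bi_H i w = true] encodes H_i = 1, i.e. the i-th null hypothesis is false.
   The tuples carry the library's product sigma-algebra, so
   [bi_indep_Hxi] is independence of the two random vectors. *)
Record BI_model (R : realType) (n : nat) := {
  bi_display : measure_display;
  bi_T : measurableType bi_display;
  bi_P : probability bi_T R;
  bi_H : 'I_n -> {RV bi_P >-> bool};
  bi_xi : 'I_n -> {RV bi_P >-> R};
  bi_U : 'I_n -> {RV bi_P >-> R};
  bi_xi01 : forall i w, 0 <= bi_xi i w <= 1;
  bi_U_unif : forall i (A : set R), measurable A ->
    distribution bi_P (bi_U i) A = uniform_prob (@ltr01 R) A;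
  bi_U_indep : mutually_independent bi_P (fun i => bi_U i : bi_T -> R);
  bi_indep_Hxi : independent_pair bi_P
    (fun w => [tuple bi_U i w | i < n])
    (fun w => [tuple (bi_H i w, bi_xi i w) | i < n]);
  bi_EN0_gt0 : ('E_bi_P[fun w => (\sum_(i < n) ~~ bi_H i w)%N%:R] > 0)%E
}.

Section Model.
Context {R : realType} {n : nat}.
Implicit Type M : BI_model R n.

Definition N0 M (w : bi_T M) : nat := (\sum_(i < n) ~~ bi_H M i w)%N.

Definition pval M (w : bi_T M) (i : 'I_n) : R :=
  (1 - (bi_H M i w)%:R) * bi_U M i w + (bi_H M i w)%:R * bi_xi M i w.

Definition C1 M : Prop :=
  mutually_independent (bi_P M) (fun i => bi_xi M i : bi_T M -> R) /\
  exists f1 : R -> R,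
    [/\ measurable_fun [set: R] f1, forall x, 0 <= f1 x,
        forall i (A : set R), measurable A ->
          distribution (bi_P M) (bi_xi M i) A =
          (\int[lebesgue_measure]_(x in A) (f1 x)%:E)%E
      & forall i t, 0 <= t <= 1 -> (t%:E <= cdf (bi_xi M i) t)%E].

(* [Pi0] is the range of the probabilities P(H_1 = 0) over the class. *)
Definition C2 (Pi0 : set R) M : Prop :=
  [/\ mutually_independent (bi_P M) (fun i => bi_H M i : bi_T M -> bool),
      exists2 pi0, Pi0 pi0 &
        forall i, bi_P M (bi_H M i @^-1` [set false]) = pi0%:E
    & independent_pair (bi_P M)
        (fun w => [tuple bi_H M i w | i < n])
        (fun w => [tuple bi_xi M i w | i < n])].

Definition fixed_N0_1 M : Prop := {ae bi_P M, forall w, N0 w = 1%N}.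

End Model.

Section StepUp.
Context {R : realType} {n : nat}.
Implicit Types (p : 'I_n -> R) (a : nat -> R).

Definition ecdf p (t : R) : R := n%:R^-1 * \sum_(i < n) (p i <= t)%R%:R.

(* The k-th smallest p-value, for 1 <= k <= n. *)
Definition order_stat p (k : nat) : R :=
  nth 0 (sort <=%R [seq p i | i <- enum 'I_n]) k.-1.

Definition su_rejections a p : nat :=
  (\max_(1 <= i < n.+1 | (order_stat p i <= a i)%R) i)%N.

Definition su_false_rejections a p (h : 'I_n -> bool) : nat :=
  #|[set i : 'I_n | (p i <= a (su_rejections a p))%R && ~~ h i]|.

(* V / (R \/ 1) *)
Definition FDP a p (h : 'I_n -> bool) : R :=
  (su_false_rejections a p h)%:R / (maxn (su_rejections a p) 1)%:R.

Definition FDR (crit : ('I_n -> R) -> nat -> R) (M : BI_model R n) : \bar R :=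
  ('E_(bi_P M)[fun w => FDP (crit (pval w)) (pval w) (bi_H M ^~ w)])%E.

End StepUp.

(* Generators of the product sigma-algebra of the coordinates in [lambda, 1].
   A function measurable for the generated sigma-algebra necessarily depends
   only on the restriction of its argument to [lambda, 1]. *)
Definition tail_cylinders {R : realType} (lambda : R) : set (set (R -> R)) :=
  [set C | exists t (B : set R),
     [/\ lambda <= t <= 1, measurable B & C = [set f | B (f t)]]].

Definition tail_measurable {R : realType} (lambda : R)
    (g : (R -> R) -> R) : Prop :=
  measurable_fun [set: g_sigma_algebraType (tail_cylinders lambda)] g.

Definition adaptive_crit {R : realType} {n : nat} (alpha0 lambda : R)
    (n0hat : (R -> R) -> R) (p : 'I_n -> R) (i : nat) : R :=
  Num.min (i%:R / n0hat (ecdf p) * alpha0) lambda.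

(* The i-th critical value equals i alpha / n almost surely, for 1 <= i <= n,
   up to the two events on which it has no influence on the rejections:
   - no p-value is <= lambda (nothing is rejected, as all critical values are
     <= lambda);
   - all p-values are <= lambda, alpha = lambda and i < n (the n-th critical
     value is lambda, so everything is rejected).
   The FDR does not constrain n0hat on these events. *)
Definition crit_eq_as {R : realType} {n : nat} (alpha0 lambda : R)
    (n0hat : (R -> R) -> R) (alpha : R) (M : BI_model R n) : Prop :=
  {ae bi_P M, forall w, forall i : nat, (1 <= i <= n)%N ->
     0 < ecdf (pval w) lambda ->
     [\/ ecdf (pval w) lambda < 1, alpha < lambda | i = n] ->
     adaptive_crit alpha0 lambda n0hat (pval w) i = i%:R / n%:R * alpha}.

(* Main.v *)
(* By the leave-one-out property of step-up tests, a true null hypothesis with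
   uniform p-value contributes, conditionally on the other p-values y, exactly
   G(y) = min(alpha0 / n0hat, lambda / m) to the FDR, where m is the number of
   p-values <= lambda once the null p-value is moved to 0.  So the FDR condition
   says E[G(Y_1, ..., Y_(n-1))] = c for i.i.d. Y_j ~ pi0 Unif + (1 - pi0) F_1.
   Choosing F_1 among the averages of uniform laws on [0, t], t in ]0, 1],
   polarization (Ryser's formula) separates the coordinates, whence the integral
   of G over every box is c times its volume and G = c almost everywhere.  The
   configurations with all p-values <= lambda give c <= lambda / n, and then
   G = c forces alpha0 / n0hat = c except on the events excluded in
   [crit_eq_as].  One value of pi0 suffices in (a), and (b) is pi0 = 0. *)

Require Import Defs.
From HB Require Import structures.
From mathcomp Require Import all_boot all_order all_algebra fingroup perm.
From mathcomp Require Import all_classical all_reals all_analysis.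
From mathcomp Require Import measurable_realfun ring lra.

Set Implicit Arguments.
Unset Strict Implicit.
Unset Printing Implicit Defensive.

Import Order.TTheory GRing.Theory Num.Theory.
Import numFieldNormedType.Exports.

Local Open Scope classical_set_scope.
Local Open Scope ring_scope.

(** The FDR condition tests G only against products of one and the same density, because all [xi_i]
    share [F_1], whereas a box has a different side in each direction. The sides can be separated
    because G is symmetric (the empirical distribution function forgets the order of the p-values)
    and because the admissible [F_1] are closed under averaging: the uniform laws on [0, t] have
    distribution functions above the diagonal, and so do their averages. The uniform component of
    weight pi0 is removed by a signed combination of the mixtures at t and at 1. The FDR hypothesis
    speaks only of realizations of the model, so each of these laws is realized on a power of a
    space of triples (U, flag, xi), with all independence requirements verified. Conversely, the
    conclusion concerns arbitrary models, where in (b) H may depend on xi. The exceptional set of G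
    = c is carried over by absolute continuity: the law of all p-values but one is dominated by the
    uniform law on the cube, so a single null set serves all models. *)

Definition rect {T : Type} {k : nat} (A : 'I_k -> set T) : set (k.-tuple T) :=
  [set t | forall i, A i (tnth t i)].

(** * Product measures on tuples *)

Section rectangles.
Context {d : measure_display} {T : measurableType d} {k : nat}.
Implicit Types (A : 'I_k -> set T) (G : set (set T)).

Lemma rectI A B : rect A `&` rect B = rect (fun i => A i `&` B i).
Proof.
apply/seteqP; split=> [t [At Bt] i|t ABt]; first by split; [exact: At|exact: Bt].
by split=> i; have [] := ABt i.
Qed.

Lemma rectT : rect (fun=> [set: T]) = [set: k.-tuple T].
Proof. by apply/seteqP; split. Qed.

Lemma rect_bigcap A :
  rect A = \bigcap_(i in [set: 'I_k]) ((@tnth k T ^~ i) @^-1` A i).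
Proof. by apply/seteqP; split=> t At i; [move=> _; exact: At|exact: At]. Qed.

Lemma measurable_rect A : (forall i, measurable (A i)) -> measurable (rect A).
Proof.
move=> mA; rewrite rect_bigcap; apply: fin_bigcap_measurable => // i _.
by rewrite -[X in measurable X]setTI; exact: measurable_tnth.
Qed.

Definition rects G : set (set (k.-tuple T)) :=
  [set rect A | A in [set A | forall i, G (A i)]].

(** The preimage of [E] under one coordinate is the box with side [E] there and [setT] elsewhere;
    [G setT] makes this box admissible, so the coordinates are measurable for the sigma-algebra
    generated by the boxes. *)
Lemma measurable_rects G : measurable = <<s G >> -> G setT ->
  measurable = <<s rects G >>.
Proof.
move=> mG GT; apply/seteqP; split; last first.
  apply: smallest_sub; first exact: sigma_algebra_measurable.
  move=> _ [A GA <-]; apply: measurable_rect => i.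
  by rewrite mG; apply: sub_sigma_algebra; exact: GA.
apply: smallest_sub; first exact: smallest_sigma_algebra.
move=> C; rewrite -bigcup_seq => -[i _ [B mB <-]].
pose S : measurableType _ := g_sigma_algebraType (rects G).
have mt : measurable_fun [set: S] (@tnth k T ^~ i).
  apply: (measurability G mG) => _ [E GE <-].
  apply: sub_sigma_algebra; rewrite setTI.
  exists (fun j => if j == i then E else setT).
    by move=> j /=; case: ifP.
  apply/seteqP; split=> t /=.
    by move=> /(_ i); rewrite eqxx.
  by move=> Et j; case: eqP => [->|].
exact: mt.
Qed.

(** Boxes with sides in a pi-system form a pi-system. Most uses take all measurable sides; the
    identification of G from its integrals over boxes takes half-lines. *)
Lemma tuple_measure_unique {R : realType} G
    (m1 m2 : {measure set (k.-tuple T) -> \bar R}) :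
  measurable = <<s G >> -> G setT -> setI_closed G -> (m1 setT < +oo)%E ->
  (forall A, (forall i, G (A i)) -> m1 (rect A) = m2 (rect A)) ->
  forall E, measurable E -> m1 E = m2 E.
Proof.
move=> mG GT GI m1T m12 E mE.
apply: (measure_unique (rects G) (fun=> setT)) => //.
- exact: measurable_rects.
- move=> _ _ [A GA <-] [B GB <-]; rewrite rectI.
  by exists (fun i => A i `&` B i) => // i; exact: GI.
- by move=> _; rewrite -rectT; exists (fun=> setT).
- by apply/seteqP; split=> // t _; exists 0%N.
- by move=> _ [A GA <-]; exact: m12.
Qed.

End rectangles.

Section power_measure.
Context {d : measure_display} {T : measurableType d} {R : realType}.
Variable P : probability T R.

Definition ucons {k} (xt : T * k.-tuple T) : k.+1.-tuple T :=
  cons_tuple xt.1 xt.2.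

Lemma measurable_ucons k : measurable_fun setT (@ucons k).
Proof. exact: measurable_cons. Qed.

HB.instance Definition _ k :=
  isMeasurableFun.Build _ _ _ _ (@ucons k) (@measurable_ucons k).

(** The new coordinate comes in front, so that Tonelli splits off [ord0], the place of the
    distinguished true null hypothesis. *)
Fixpoint power (k : nat) : probability (k.-tuple T) R :=
  match k with
  | 0 => \d_[tuple]
  | k.+1 => distribution (P \x power k)%E (@ucons k)
  end.

Local Open Scope ereal_scope.

Lemma ge0_integral_power k (f : k.+1.-tuple T -> \bar R) :
  measurable_fun setT f -> (forall t, 0 <= f t) ->
  \int[power k.+1]_t f t = \int[P]_x \int[power k]_t f (ucons (x, t)).
Proof.
move=> mf f0.
have -> : \int[power k.+1]_t f t =
    \int[distribution (P \x power k) (@ucons k)]_t f t by [].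
rewrite ge0_integral_distribution// fubini_tonelli1//.
- exact: measurableT_comp.
- by move=> x; exact: f0.
Qed.

Lemma ge0_integral_power_swap k (f : k.+1.-tuple T -> \bar R) :
  measurable_fun setT f -> (forall t, 0 <= f t) ->
  \int[power k.+1]_t f t = \int[power k]_t \int[P]_x f (ucons (x, t)).
Proof.
move=> mf f0; rewrite ge0_integral_power//.
apply: (@fubini_tonelli _ _ _ _ _ _ _ (f \o @ucons k)).
- exact: measurableT_comp.
- by move=> x; exact: f0.
Qed.

Lemma power_rect k (A : 'I_k -> set T) : (forall i, measurable (A i)) ->
  power k (rect A) = \prod_(i < k) P (A i).
Proof.
elim: k A => [|k IH] A mA.
  by rewrite big_ord0/= diracE mem_set// => -[].
rewrite big_ord_recl -IH//.
rewrite -product_measure1E//; last exact: measurable_rect.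
congr (product_measure1 _ _ _); apply/seteqP; split=> -[x t] /=.
  move=> At; split; first exact: (At ord0).
  by move=> i /=; have := At (lift ord0 i); rewrite tnthS.
move=> [Ax At] i; case: (unliftP ord0 i) => [j ->|->//].
by rewrite tnthS; exact: At.
Qed.

End power_measure.
Arguments power {d T R} P k.

Lemma measurable_bigprod {d d'} {T : measurableType d} {T' : measurableType d'}
    {R : realType} k (f : 'I_k -> T' -> \bar R) (g : 'I_k -> T -> T') :
  (forall i, measurable_fun setT (f i)) ->
  (forall i, measurable_fun setT (g i)) ->
  measurable_fun setT (fun t => \prod_(i < k) f i (g i t))%E.
Proof.
move=> mf mg; elim: k => [|k IH] in f g mf mg *.
  by under eq_fun do rewrite big_ord0; exact: measurable_cst.
under eq_fun do rewrite big_ord_recl.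
apply: emeasurable_funM; first exact: measurableT_comp.
exact: (IH (fun i => f (lift ord0 i)) (fun i => g (lift ord0 i))).
Qed.

Section power_integrals.
Context {d : measure_display} {T : measurableType d} {R : realType}.
Variable P : probability T R.
Local Open Scope ereal_scope.

Lemma ge0_integral_power_prod k (f : 'I_k -> T -> \bar R) :
  (forall i, measurable_fun setT (f i)) -> (forall i x, 0 <= f i x) ->
  \int[power P k]_t (\prod_(i < k) f i (tnth t i)) =
  \prod_(i < k) \int[P]_x f i x.
Proof.
elim: k f => [|k IH] f mf f0.
  under eq_integral do rewrite big_ord0.
  by rewrite big_ord0 integral_cst//= diracT mule1.
rewrite ge0_integral_power; last 2 first.
- by apply: measurable_bigprod => // i; exact: measurable_tnth.
- by move=> t; exact: prode_ge0.
rewrite big_ord_recl -ge0_integralZr//; last first.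
  by apply: prode_ge0 => i _; exact: integral_ge0.
apply: eq_integral => x _; rewrite -IH// -ge0_integralZl//.
- by apply: eq_integral => t _; rewrite big_ord_recl; congr (_ * _);
    apply: eq_bigr => i _; rewrite tnthS.
- by apply: (@measurable_bigprod _ _ _ _ _ _ (fun i => f (lift ord0 i))
    (fun i t => tnth t i)) => // i; exact: measurable_tnth.
- by move=> t _; exact: prode_ge0.
Qed.

Definition permt k (s : 'S_k) (t : k.-tuple T) : k.-tuple T :=
  [tuple tnth t (s i) | i < k].

Lemma measurable_permt k (s : 'S_k) : measurable_fun setT (permt s).
Proof.
apply/measurable_fun_tnthP => i /=.
rewrite (_ : _ \o _ = @tnth _ T ^~ (s i)); first exact: measurable_tnth.
by apply/funext => t /=; rewrite tnth_mktuple.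
Qed.

HB.instance Definition _ k (s : 'S_k) :=
  isMeasurableFun.Build _ _ _ _ (permt s) (measurable_permt s).

Lemma distribution_permt k (s : 'S_k) E : measurable E ->
  distribution (power P k) (permt s) E = power P k E.
Proof.
move: E; apply: (@tuple_measure_unique _ _ _ _ measurable) => //.
- by rewrite sigma_algebra_id//; exact: sigma_algebra_measurable.
- exact: measurableI.
- by rewrite [X in (X < _)%E]probability_setT ltry.
move=> A mA.
suff : distribution (power P k) (permt s) (rect A) = power P k (rect A) by [].
rewrite power_rect// /distribution /pushforward.
rewrite (_ : _ @^-1` _ = rect (fun i => A (s^-1%g i))); last first.
  apply/seteqP; split=> t /= At i.
    by have := At (s^-1%g i); rewrite tnth_mktuple permKV.
  by have := At (s i); rewrite tnth_mktuple permK.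
by rewrite power_rect// (reindex_inj (@perm_inj _ s))/=; apply: eq_bigr => i _;
  rewrite permK.
Qed.

Lemma ge0_integral_power_permt k (s : 'S_k) (f : k.-tuple T -> \bar R) :
  measurable_fun setT f -> (forall t, 0 <= f t) ->
  \int[power P k]_t f (permt s t) = \int[power P k]_t f t.
Proof.
move=> mf f0; rewrite -[LHS](ge0_integral_distribution (permt s))//.
by apply: eq_measure_integral => A mA _; exact: distribution_permt.
Qed.

End power_integrals.

(** * Densities, uniform laws and absolute continuity *)

Section density.
Context {d : measure_display} {T : measurableType d} {R : realType}.
Variables (mu : probability T R) (f : T -> \bar R).
Hypotheses (mf : measurable_fun setT f) (f0 : forall x, (0 <= f x)%E).
Hypothesis f_fin : (\int[mu]_x f x < +oo)%E.
Local Open Scope ereal_scope.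

(** The three properties of [f] are arguments, so that the measure instances declared below can
    recover them from the term. *)
Definition density_measure of measurable_fun setT f & (forall x, 0 <= f x) &
  \int[mu]_x f x < +oo := fun A => \int[mu]_(x in A) f x.

Local Notation D := (density_measure mf f0 f_fin).

Let D0 : D set0 = 0. Proof. by rewrite /D integral_set0. Qed.

Let D_ge0 A : 0 <= D A. Proof. by apply: integral_ge0 => x _; exact: f0. Qed.

Let D_sigma_additive : semi_sigma_additive D.
Proof.
move=> F mF tF mUF; rewrite /D /density_measure; apply: cvg_toP.
  apply: ereal_nondecreasing_is_cvgn => m n mn.
  apply: lee_sum_nneg_natr => // k _ _.
  by apply: integral_ge0 => x _; exact: f0.
by rewrite ge0_integral_bigcup//; exact: measurable_funTS.
Qed.

HB.instance Definition _ := isMeasure.Build _ _ _ D D0 D_ge0 D_sigma_additive.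

Let D_fin : fin_num_fun D.
Proof.
move=> A mA; rewrite ge0_fin_numE//; apply: le_lt_trans f_fin.
by apply: ge0_subset_integral => //; exact: measurable_funTS.
Qed.

HB.instance Definition _ := @Measure_isFinite.Build _ _ _ D D_fin.

End density.

Section uniform.
Context {R : realType}.

Definition borel_id : measurableTypeR R -> R := id.

Lemma measurable_borel_id : measurable_fun setT borel_id.
Proof. by move=> _ Y mY; rewrite setTI. Qed.

HB.instance Definition _ := isMeasurableFun.Build _ _ (measurableTypeR R) R
  borel_id measurable_borel_id.

(* The library's [uniform_prob] lives on another presentation of the Borel
   sigma-algebra of [R], with a different display; it is transported to [R]. *)
Definition uniform0 (t : R) (t0 : 0 < t) : probability R R :=
  distribution (uniform_prob t0) borel_id.

Lemma uniform0E (t : R) (t0 : 0 < t) A : uniform0 t0 A = uniform_prob t0 A.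
Proof. by []. Qed.

Lemma ge0_integral_uniform0 (t : R) (t0 : 0 < t) (f : R -> \bar R) :
  measurable_fun setT f -> (forall x, 0 <= f x)%E ->
  (\int[uniform0 t0]_x f x =
   (t^-1)%:E * \int[lebesgue_measure]_(x in [set` `[0, t]%R]) f x)%E.
Proof.
move=> mf f0; rewrite [LHS]ge0_integral_distribution// integral_uniform ?subr0//.
Qed.

Lemma uniform0_ray (t : R) (t0 : 0 < t) (x : R) : 0 <= x ->
  uniform0 t0 `]-oo, x]%classic = (Num.min x t / t)%:E.
Proof.
move=> x0; rewrite uniform0E /uniform_prob integral_uniform_pdf.
rewrite (_ : _ `&` _ = `[0, Num.min x t]%classic); last first.
  apply/seteqP; split=> y /=; rewrite !in_itv/= le_min; first by case=> -> /andP[-> ->].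
  by case/and3P => -> -> ->.
rewrite (eq_integral (fun=> (t^-1)%:E)) => [|y]; last first.
  rewrite inE/= in_itv/= le_min => /and3P[y0 _ yt].
  by rewrite /uniform_pdf y0 yt subr0.
rewrite integral_cst//= lebesgue_measure_itv/= lte_fin.
case: ltP => m0; first by rewrite sube0 -EFinM mulrC.
rewrite mule0; suff -> : Num.min x t = 0 by rewrite mul0r.
by apply/eqP; rewrite eq_le m0 le_min x0 ltW.
Qed.

Definition unif01 : probability R R := uniform0 ltr01.

Lemma ge0_integral_uniform0_density (t : R) (t0 : 0 < t) (f : R -> \bar R) :
  t <= 1 -> measurable_fun setT f -> (forall x, 0 <= f x)%E ->
  (\int[uniform0 t0]_x f x = \int[unif01]_x ((uniform_pdf 0 t x)%:E * f x))%E.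
Proof.
move=> t1 mf f0; have mpdf := measurable_uniform_pdf (0 : R) t.
have pdf0 x := uniform_pdf_ge0 x t0.
rewrite !ge0_integral_uniform0//.
- rewrite invr1 mul1e -ge0_integralZl//=; last 2 first.
  + exact: measurable_funTS.
  + by rewrite lee_fin invr_ge0 ltW.
  rewrite [LHS]integral_mkcond [RHS]integral_mkcond; apply: eq_integral => x _.
  rewrite !patchE !mem_setE !in_itv/= /uniform_pdf.
  case: (boolP (0 <= x <= t)) => [/andP[x0 xt]|_]; last by rewrite mul0e; case: ifP.
  by rewrite x0 (le_trans xt t1)/= subr0.
- by apply: emeasurable_funM => //; exact/measurable_EFinP.
- by move=> x; rewrite mule_ge0// lee_fin.
Qed.

End uniform.
Arguments unif01 R : clear implicits.

Section independent_densities.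
Context {d d' : measure_display} {T : measurableType d} {T' : measurableType d'}
  {R : realType}.
Variables (P : probability T' R) (mu : probability T R).
Local Open Scope ereal_scope.

Lemma measurable_mktuple k (X : 'I_k -> T' -> T) :
  (forall i, measurable_fun setT (X i)) ->
  measurable_fun setT (fun w => [tuple X i w | i < k]).
Proof.
move=> mX; apply/measurable_fun_tnthP => i /=.
rewrite (_ : _ \o _ = X i); first exact: mX.
by apply/funext => t /=; rewrite tnth_mktuple.
Qed.

Lemma preimage_mktuple_rect k (X : 'I_k -> T' -> T) (A : 'I_k -> set T) :
  (fun w => [tuple X i w | i < k]) @^-1` rect A =
  \bigcap_(i in [set: 'I_k]) X i @^-1` A i.
Proof.
apply/seteqP; split=> w /= Aw i; first by move=> _; have := Aw i; rewrite tnth_mktuple.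
by rewrite tnth_mktuple; exact: Aw.
Qed.

(** The joint law of the [X i] and the measure with the product density [F] agree on boxes, hence
    everywhere; so the joint law is absolutely continuous with respect to [power mu k]. *)
Lemma independent_densities_null k (X : 'I_k -> T' -> T) (f : 'I_k -> T -> \bar R)
    (N : set (k.-tuple T)) :
  (forall i, measurable_fun setT (X i)) ->
  (forall i, measurable_fun setT (f i)) -> (forall i x, 0 <= f i x) ->
  (forall i A, measurable A -> P (X i @^-1` A) = \int[mu]_(x in A) f i x) ->
  (forall A : 'I_k -> set T, (forall i, measurable (A i)) ->
    P (\bigcap_(i in [set: 'I_k]) X i @^-1` A i) =
    \prod_(i < k) P (X i @^-1` A i)) ->
  measurable N -> power mu k N = 0 ->
  P ((fun w => [tuple X i w | i < k]) @^-1` N) = 0.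
Proof.
move=> mX mf f0 PX indX mN N0.
have mXt := measurable_mktuple mX.
pose XM := HB.pack_for {mfun T' >-> k.-tuple T} (fun w => [tuple X i w | i < k])
  (isMeasurableFun.Build _ _ _ _ _ mXt).
pose F (t : k.-tuple T) := \prod_(i < k) f i (tnth t i).
have mF : measurable_fun setT F.
  by apply: measurable_bigprod => // i; exact: measurable_tnth.
have F0 t : 0 <= F t by apply: prode_ge0.
have Fprod (A : 'I_k -> set T) : (forall i, measurable (A i)) ->
    \int[power mu k]_(t in rect A) F t = \prod_(i < k) \int[mu]_(x in A i) f i x.
  move=> mA; rewrite integral_mkcond.
  under [RHS]eq_bigr do rewrite integral_mkcond.
  rewrite -ge0_integral_power_prod//.
  - apply: eq_integral => t _; rewrite patchE; case: ifPn => [|].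
      rewrite inE => At; apply: eq_bigr => i _.
      by rewrite patchE mem_set//; exact: At.
    rewrite notin_setE => nAt.
    have [i nAi] : exists i, ~ A i (tnth t i) by apply/existsNP => H; exact: nAt.
    by rewrite (bigD1 i)//= patchE memNset// mul0e.
  - by move=> i; apply/(measurable_restrictT _ (mA i)); exact: measurable_funTS.
  - by move=> i x; exact: erestrict_ge0.
have Ffin : \int[power mu k]_t F t < +oo.
  rewrite -rectT Fprod// big1 ?ltry// => i _.
  by rewrite -PX// preimage_setT probability_setT.
suff <- : \int[power mu k]_(t in N) F t = P (XM @^-1` N).
  by apply: null_set_integral => //; exact: measurable_funTS.
pose D := density_measure mF F0 Ffin.
suff DE : forall E, measurable E -> D E = distribution P XM E by exact: DE.
apply: (@tuple_measure_unique _ _ _ _ measurable D (distribution P XM)) => //.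
- by rewrite sigma_algebra_id//; exact: sigma_algebra_measurable.
- exact: measurableI.
- move=> A mA.
  rewrite [LHS]Fprod// [RHS](_ : _ = P (XM @^-1` rect A))//.
  by rewrite preimage_mktuple_rect indX//; apply: eq_bigr => i _; rewrite PX.
Qed.

End independent_densities.

(** * Step-up tests with capped linear critical values *)

Section step_up.
Context {R : realType} {n : nat}.
Implicit Types (p q : 'I_n -> R) (a : nat -> R).

Definition cnt p (t : R) : nat := (\sum_(j < n) (p j <= t)%R)%N.

Lemma cnt_le_size p t : (cnt p t <= n)%N.
Proof.
rewrite /cnt -[X in (_ <= X)%N](card_ord n) -sum1_card.
by apply: leq_sum => i _; case: (_ <= _)%R.
Qed.

Lemma cnt_mono p (s t : R) : s <= t -> (cnt p s <= cnt p t)%N.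
Proof.
move=> st; apply: leq_sum => j _.
by have [/le_trans->|] := boolP (p j <= s).
Qed.

Lemma order_stat_le p k t : (1 <= k <= n)%N ->
  (order_stat p k <= t) = (k <= cnt p t)%N.
Proof.
move=> /andP[k1 kn]; rewrite /order_stat; set s := sort _ _.
have s_sorted : sorted <=%O s by apply: sort_sorted; exact: le_total.
have -> : cnt p t = count (<= t) s.
  rewrite /s count_sort count_map -sum1_count /cnt [RHS]big_mkcond big_enum/=.
  by apply: eq_bigr => i _; case: (_ <= _)%R.
have ks : (k.-1 < size s)%N by rewrite size_sort size_map size_enum_ord prednK.
apply/idP/idP => [|kt].
  apply: contraLR; rewrite -ltNge -ltnNge => kt.
  by apply: nth_count_gt => //; rewrite ks andbT -ltnS prednK.
by apply: nth_count_le => //; rewrite prednK.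
Qed.

Section rejections.
Variables (a : nat -> R) (p : 'I_n -> R).
Local Notation r := (su_rejections a p).

(** R depends on the p-values through their counting function only. Permutation invariance and the
    leave-one-out comparison both rest on this form. *)
Lemma su_rejectionsE :
  r = (\max_(1 <= i < n.+1 | (i <= cnt p (a i))%N) i)%N.
Proof.
rewrite /su_rejections big_nat_cond [RHS]big_nat_cond; apply: eq_bigl => i.
by rewrite ltnS; case: (boolP (1 <= i <= n)%N) => //= i1n; rewrite order_stat_le.
Qed.

Lemma su_rejections_ge i : (1 <= i <= n)%N -> (i <= cnt p (a i))%N -> (i <= r)%N.
Proof.
move=> i1n ia; rewrite su_rejectionsE.
by apply: (@leq_bigmax_seq _ _ _ id) => //; rewrite mem_index_iota ltnS.
Qed.

Lemma su_rejections_cnt : (r <= cnt p (a r))%N.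
Proof.
rewrite su_rejectionsE.
apply: (@big_ind _ (fun i => (i <= cnt p (a i))%N)) => // x y.
by rewrite /maxn; case: ifP.
Qed.

Lemma su_rejections_le_size : (r <= n)%N.
Proof. exact: leq_trans su_rejections_cnt (cnt_le_size _ _). Qed.

End rejections.

(** The summand of hypothesis [i] in the false discovery proportion when it is true; the FDR is
    analysed one summand at a time. *)
Definition reject_share a p (i : 'I_n) : R :=
  (p i <= a (su_rejections a p))%R%:R / (maxn (su_rejections a p) 1)%:R.

Lemma reject_share_ge0 a p i : 0 <= reject_share a p i.
Proof. by rewrite divr_ge0. Qed.

Lemma FDPE a p h : FDP a p h = \sum_(i < n) (~~ h i)%:R * reject_share a p i.
Proof.
rewrite /FDP /reject_share /su_false_rejections -sum1_card natr_sum mulr_suml.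
rewrite big_mkcond/=; apply: eq_bigr => i _.
have -> : (i \in in_set [set j | (p j <= a (su_rejections a p)) && ~~ h j]) =
    (p i <= a (su_rejections a p)) && ~~ h i by exact: asboolb.
by case: (_ <= _)%R; case: (h i); rewrite /= ?(mul1r, mul0r).
Qed.

Section capped_linear.
Variables (b lambda : R).
Hypotheses (b_gt0 : 0 < b) (lambda_gt0 : 0 < lambda).
Let a (i : nat) : R := Num.min (i%:R * b) lambda.

Let a_mono i j : (i <= j)%N -> a i <= a j.
Proof.
by move=> ij; rewrite /a le_min !ge_min lexx orbT andbT ler_wpM2r ?ler_nat// ltW.
Qed.

Let a_ge0 i : 0 <= a i.
Proof. by rewrite /a le_min (ltW lambda_gt0) andbT mulr_ge0// ltW. Qed.

Let a_le_lambda i : a i <= lambda.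
Proof. by rewrite /a ge_min lexx orbT. Qed.

Variables (p q : 'I_n -> R) (i : 'I_n).
Hypotheses (qi : q i = 0) (qp : forall j, j != i -> q j = p j).
Local Notation r := (su_rejections a p).
Local Notation r' := (su_rejections a q).

Lemma su_rejections0_gt0 : (0 < r')%N.
Proof.
have n0 : (0 < n)%N by case: (n) i => // -[].
apply: su_rejections_ge; rewrite ?n0//.
by rewrite /cnt (bigD1 i)//= qi a_ge0.
Qed.

(** All critical values are at most [lambda], so R is at most m = [cnt q lambda]. If m b >= lambda,
    the m-th critical value is already [lambda], whence R = m and the ratio is lambda / m. Otherwise
    the cap is inactive at R and the ratio is [b]. *)
Lemma capped_crit_div :
  a r' / r'%:R = Num.min b (lambda / (cnt q lambda)%:R).
Proof.
have r'0 := su_rejections0_gt0.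
have rR : 0 < r'%:R :> R by rewrite ltr0n.
have rm : (r' <= cnt q lambda)%N.
  by apply: leq_trans (su_rejections_cnt _ _) _; exact: cnt_mono.
have mR : 0 < (cnt q lambda)%:R :> R by rewrite ltr0n (leq_trans r'0).
have rmR : r'%:R <= (cnt q lambda)%:R :> R by rewrite ler_nat.
have [mb|mb] := leP lambda ((cnt q lambda)%:R * b).
  have am : a (cnt q lambda) = lambda by rewrite /a min_r.
  have -> : r' = cnt q lambda.
    apply/eqP; rewrite eqn_leq rm/=; apply: su_rejections_ge.
      by rewrite (leq_trans r'0 rm) cnt_le_size.
    by rewrite am.
  by rewrite am min_r// ler_pdivrMr// mulrC.
rewrite [LHS](_ : _ = b); last first.
  rewrite /a min_l; first by rewrite mulrC mulKf// gt_eqF.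
  by apply: le_trans (ltW mb); rewrite ler_wpM2r// ltW.
by rewrite min_l// ler_pdivlMr// mulrC ltW.
Qed.

(** Moving [p i] down to 0 can only increase R, say to R'. If [p i] is at most the R'-th critical
    value, both vectors have the same count at that level, so R = R'. Otherwise the R-th critical
    value, being at most the R'-th, lies below [p i] and hypothesis [i] is not rejected. So [p i]
    enters through a single indicator. *)
Lemma reject_share_small : p i <= lambda ->
  reject_share a p i = (p i <= a r')%R%:R / r'%:R.
Proof.
move=> pil.
have pq t : (0 <= t) -> (cnt p t <= cnt q t)%N.
  move=> t0; apply: leq_sum => j _; have [->|/qp->//] := eqVneq j i.
  by rewrite qi t0 leq_b1.
have rr' : (r <= r')%N.
  have [->//|r0] := posnP r.
  apply: su_rejections_ge; first by rewrite r0 su_rejections_le_size.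
  by apply: leq_trans (su_rejections_cnt _ _) _; exact: pq.
have qp_eq t : p i <= t -> 0 <= t -> cnt p t = cnt q t.
  move=> pit t0; apply: eq_bigr => j _; have [->|/qp->//] := eqVneq j i.
  by rewrite qi t0 pit.
have r'0 := su_rejections0_gt0.
rewrite /reject_share; have [pir'|pir'] := leP (p i) (a r').
  have -> : r = r'.
    apply/eqP; rewrite eqn_leq rr'/=; apply: su_rejections_ge.
      by rewrite r'0 su_rejections_le_size.
    by rewrite qp_eq//; exact: su_rejections_cnt.
  by rewrite pir' (maxn_idPl r'0).
rewrite [p i <= _]leNgt (le_lt_trans _ pir') ?mul0r//.
exact: a_mono.
Qed.

Lemma reject_share_large : lambda < p i -> reject_share a p i = 0.
Proof.
by move=> lp; rewrite /reject_share leNgt (le_lt_trans _ lp) ?mul0r.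
Qed.

End capped_linear.

End step_up.

(** The bits cut the domain into finitely many measurable cells on which [f] is constant. Step-up
    statistics are of this kind, being determined by finitely many comparisons. *)
Lemma measurable_finite_bits {d d'} {X : measurableType d} {Y : measurableType d'}
    (I : finType) (b : I -> X -> bool) (f : X -> Y) :
  (forall i, measurable_fun setT (b i)) ->
  (forall x x', (forall i, b i x = b i x') -> f x = f x') ->
  measurable_fun setT f.
Proof.
move=> mb bf _ B mB; rewrite setTI.
pose bits x := [ffun i => b i x].
rewrite (_ : f @^-1` B =
  \bigcup_(v in [set bits x | x in f @^-1` B])
    \bigcap_(i in [set: I]) (b i @^-1` [set v i])).
  apply: fin_bigcup_measurable => [|v _]; first exact: finite_finset.
  apply: fin_bigcap_measurable => [|i _]; first exact: finite_finset.
  by rewrite -[X in measurable X]setTI; exact: mb.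
apply/seteqP; split=> [x Bx|x [_ [x' Bx' <-]] xx'].
  by exists (bits x); [exists x|move=> i _ /=; rewrite ffunE].
rewrite /= (bf x x')// => i.
by have := xx' i Logic.I; rewrite /= ffunE.
Qed.

Lemma measurable_natr_bool {d} {X : measurableType d} {R : realType}
    (b : X -> bool) :
  measurable_fun setT b -> measurable_fun setT (fun x => (b x)%:R : R).
Proof.
move=> mb; apply: (@measurable_finite_bits _ _ _ _ unit (fun=> b)) => // x x'.
by move=> /(_ tt) ->.
Qed.

Lemma measurable_invr_gt0 {d} {X : measurableType d} {R : realType}
    (h : X -> R) : (forall x, 0 < h x) ->
  measurable_fun setT h -> measurable_fun setT (fun x => (h x)^-1).
Proof.
move=> h0 mh.
suff : measurable_fun setT (GRing.inv \o h) by [].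
apply: (measurable_comp (F := (`]0, +oo[ : set R))) => //.
  by move=> _ [x _ <-] /=; rewrite in_itv/= andbT.
apply: open_continuous_measurable_fun; first exact: interval_open.
move=> x; rewrite inE/= in_itv/= andbT => x0.
by apply: inv_continuous; rewrite gt_eqF.
Qed.

(** * Adaptive critical values: dependence on the tail, symmetry and measurability *)

Section tail.
Context {R : realType}.
Variables (lambda : R) (g : (R -> R) -> R).
Hypothesis mg : tail_measurable lambda g.

(** The sets of functions that do not separate [f] from [h] form a sigma-algebra containing the
    cylinders; the preimage under [g] of the point [g f] belongs to it. *)
Lemma tail_measurable_ext (f h : R -> R) :
  (forall t, lambda <= t <= 1 -> f t = h t) -> g f = g h.
Proof.
move=> fh.
pose S : set (set (R -> R)) := [set C | C f <-> C h].
have sub : <<s tail_cylinders lambda >> `<=` S.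
  apply: smallest_sub => [|C [t [B [t1 mB ->]]]]; last first.
    by rewrite /S/= fh.
  split=> [|A|A].
  - by [].
  - by move=> AA; split=> -[_ nA]; split=> // /AA.
  - by move=> AS; split=> -[i _ Ai]; exists i => //; exact/AS.
have := mg measurableT (measurable_set1 (g f)).
by rewrite setTI => mC; have [/(_ erefl) /= ->] := sub _ mC.
Qed.

End tail.

Section adaptive.
Context {R : realType} {n : nat}.
Variables (alpha0 lambda : R) (n0hat : (R -> R) -> R).
Hypotheses (alpha0_gt0 : 0 < alpha0) (lambda_gt0 : 0 < lambda).
Hypothesis (n0_gt0 : forall f, 0 < n0hat f).
Hypothesis mn0 : tail_measurable lambda n0hat.

Implicit Types p q : 'I_n -> R.

Definition slope (p : 'I_n -> R) : R := alpha0 / n0hat (ecdf p).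

Lemma slope_gt0 p : 0 < slope p.
Proof. exact: divr_gt0. Qed.

Lemma adaptive_critE p : adaptive_crit alpha0 lambda n0hat p =
  fun i => Num.min (i%:R * slope p) lambda.
Proof. by apply/funext => i; rewrite /adaptive_crit /slope mulrAC mulrA. Qed.

Lemma ecdfE p t : ecdf p t = n%:R^-1 * (cnt p t)%:R :> R.
Proof. by rewrite /ecdf /cnt natr_sum. Qed.

Lemma eq_cnt_perm p q (s : 'S_n) t : (forall i, q i = p (s i)) ->
  cnt q t = cnt p t.
Proof.
move=> qp; rewrite [RHS](reindex_inj (@perm_inj _ s))/=.
by apply: eq_bigr => i _; rewrite qp.
Qed.

Lemma eq_slope_perm p q (s : 'S_n) : (forall i, q i = p (s i)) ->
  slope q = slope p.
Proof.
move=> qp; congr (alpha0 / n0hat _); apply/funext => t.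
by rewrite !ecdfE (eq_cnt_perm _ qp).
Qed.

Lemma eq_slope_tail p q : (forall t, lambda <= t -> cnt p t = cnt q t) ->
  slope p = slope q.
Proof.
move=> pq; congr (alpha0 / _); apply: (tail_measurable_ext mn0) => t /andP[lt _].
by rewrite !ecdfE pq.
Qed.

Definition adaptive_share p i : R :=
  reject_share (adaptive_crit alpha0 lambda n0hat p) p i.

Lemma adaptive_share_perm p q (s : 'S_n) i : (forall i, q i = p (s i)) ->
  adaptive_share q i = adaptive_share p (s i).
Proof.
move=> qp; rewrite /adaptive_share !adaptive_critE (eq_slope_perm qp).
set a := fun=> _; rewrite /reject_share.
have -> : su_rejections a q = su_rejections a p.
  rewrite !su_rejectionsE.
  by under eq_bigl do rewrite (eq_cnt_perm _ qp).
by rewrite qp.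
Qed.

Section measurability.
Context {d} {X : measurableType d}.
Variable p : X -> 'I_n -> R.
Hypothesis mp : forall i, measurable_fun setT (p ^~ i).

Lemma measurable_cnt t : measurable_fun setT (fun x => (cnt (p x) t)%:R : R).
Proof.
rewrite /cnt; under eq_fun do rewrite natr_sum.
apply: measurable_sum => j; apply: measurable_natr_bool.
by apply: measurable_fun_ler => //; exact: measurable_cst.
Qed.

Lemma measurable_slope : measurable_fun setT (fun x => slope (p x)).
Proof.
pose E : X -> g_sigma_algebraType (tail_cylinders lambda) := fun x => ecdf (p x).
have mE : measurable_fun setT E.
  apply: (@measurability _ _ _ (g_sigma_algebraType (tail_cylinders lambda)) _ _
    (tail_cylinders lambda) erefl) => _ [_ [t [B [t1 mB ->]]] <-].
  rewrite setTI (_ : _ @^-1` _ = (fun x => ecdf (p x) t) @^-1` B)//.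
  rewrite -[X in measurable X]setTI.
  have : measurable_fun setT (fun x => ecdf (p x) t).
    under eq_fun do rewrite ecdfE.
    by apply: measurable_funM; [exact: measurable_cst|exact: measurable_cnt].
  exact.
have mnE : measurable_fun setT (fun x => n0hat (E x)) by exact: measurableT_comp.
apply: measurable_funM; first exact: measurable_cst.
by apply: measurable_invr_gt0 => // x; exact: n0_gt0.
Qed.

Lemma measurable_adaptive_share i :
  measurable_fun setT (fun x => adaptive_share (p x) i).
Proof.
pose a x m := Num.min (m%:R * slope (p x)) lambda.
(* The comparisons of every p-value with every critical value of index at most n determine R, and
   then the share. *)
apply: (@measurable_finite_bits _ _ _ _ ('I_n.+1 * 'I_n)%type
  (fun mj x => p x mj.2 <= a x mj.1)) => [[m j]/=|x x' xx'].
  apply: measurable_fun_ler => //; apply: measurable_minr => //.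
  by apply: measurable_funM => //; exact: measurable_slope.
have bits m j : (m <= n)%N -> (p x j <= a x m) = (p x' j <= a x' m).
  by rewrite -ltnS => mn; exact: (xx' (Ordinal mn, j)).
rewrite /adaptive_share !adaptive_critE -!/(a _).
have rr : su_rejections (a x) (p x) = su_rejections (a x') (p x').
  rewrite !su_rejectionsE big_nat_cond [RHS]big_nat_cond; apply: eq_bigl => m.
  case: (boolP (_ <= m < _)%N) => //= /andP[_]; rewrite ltnS => mn.
  by congr (m <= _)%N; apply: eq_bigr => j _; rewrite bits.
by rewrite /reject_share rr bits// -rr su_rejections_le_size.
Qed.

End measurability.

Lemma adaptive_share_ge0 p i : 0 <= adaptive_share p i.
Proof. exact: reject_share_ge0. Qed.

End adaptive.

(** * The expected share of a true null hypothesis given the other p-values *)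

Section conditional_share.
Context {R : realType} {k : nat}.
Variables (alpha0 lambda : R) (n0hat : (R -> R) -> R).
Hypotheses (alpha0_gt0 : 0 < alpha0) (lambda_gt0 : 0 < lambda).
Hypothesis lambda_lt1 : lambda < 1.
Hypothesis (n0_gt0 : forall f, 0 < n0hat f).
Hypothesis mn0 : tail_measurable lambda n0hat.

(* The expected share of a true null hypothesis in the rejections, given the
   other p-values [y]; replacing the p-value of the null by [0] changes neither
   the tail of the empirical distribution nor the number of rejections as long
   as this null is rejected. *)
Definition cond_share (y : k.-tuple R) : R :=
  Num.min (slope alpha0 n0hat (tnth (ucons (0 : R, y))))
          (lambda / (cnt (tnth (ucons (0 : R, y))) lambda)%:R).

(** A null p-value u above [lambda] is never rejected. Below, the slope is that of [q] and the share
    is the indicator of u <= a r, divided by r. Since a r <= lambda < 1, the uniform integral is a r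
    / r, which [capped_crit_div] evaluates. *)
Lemma integral_adaptive_share (y : k.-tuple R) :
  (\int[unif01 R]_u
     (adaptive_share alpha0 lambda n0hat (tnth (ucons (u, y))) ord0)%:E =
  (cond_share y)%:E)%E.
Proof.
set q := tnth (ucons (0 : R, y)).
have q0 : q ord0 = 0 by [].
pose a (i : nat) : R := Num.min (i%:R * slope alpha0 n0hat q) lambda.
pose r := su_rejections a q.
have sl0 : 0 < slope alpha0 n0hat q by exact: slope_gt0.
have r0 : (0 < r)%N by apply: (su_rejections0_gt0 sl0 lambda_gt0 q0).
have arl : a r <= lambda by rewrite /a ge_min lexx orbT.
have ar0 : 0 <= a r by rewrite /a le_min (ltW lambda_gt0) andbT mulr_ge0// ltW.
have shareE u : adaptive_share alpha0 lambda n0hat (tnth (ucons (u, y))) ord0 =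
    (r%:R)^-1 * \1_(`]-oo, a r]) u.
  set p := tnth (ucons (u, y)).
  have qp j : j != ord0 -> q j = p j.
    by case: (unliftP ord0 j) => [j' ->|->]; rewrite ?eqxx// /q /p !tnthS.
  rewrite indicE mem_setE in_itv/= /adaptive_share adaptive_critE.
  have [lu|ul] := ltP lambda u.
    rewrite reject_share_large// leNgt (le_lt_trans arl lu) mulr0//.
  have -> : slope alpha0 n0hat p = slope alpha0 n0hat q.
    apply: (eq_slope_tail _ mn0) => t lt; apply: eq_bigr => j _.
    have [->|/qp->//] := eqVneq j ord0.
    by rewrite q0 (le_trans (ltW lambda_gt0) lt) (le_trans ul lt).
  by rewrite (reject_share_small sl0 lambda_gt0 q0 qp ul) mulrC.
under eq_integral do rewrite shareE EFinM.
rewrite ge0_integralZl//=; last first.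
  by apply/measurable_EFinP; exact: measurable_indic.
rewrite integral_indic// setIT [X in (_ * X)%E = _](uniform0_ray _ ar0).
rewrite min_l ?divr1 -?EFinM; last by rewrite (le_trans arl)// ltW.
by rewrite mulrC (capped_crit_div sl0 lambda_gt0 q0).
Qed.

Lemma measurable_cond_share : measurable_fun setT cond_share.
Proof.
have mq (i : 'I_k.+1) : measurable_fun setT
    (fun y : k.-tuple R => tnth (ucons (0 : R, y)) i).
  case: (unliftP ord0 i) => [j ->|->]; last exact: measurable_cst.
  by under eq_fun do rewrite tnthS; exact: measurable_tnth.
apply: measurable_minr.
  exact: (measurable_slope _ n0_gt0 mn0 mq).
apply: measurable_funM; first exact: measurable_cst.
apply: measurable_invr_gt0; last exact: (measurable_cnt mq).
by move=> y; rewrite ltr0n /cnt big_ord_recl/= ltW.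
Qed.

Lemma cond_share_ge0 y : 0 <= cond_share y.
Proof. by rewrite le_min ltW ?slope_gt0// divr_ge0// ltW. Qed.

Lemma cond_share_le y : cond_share y <= lambda.
Proof.
rewrite ge_min; apply/orP; right; rewrite ler_pdivrMr.
  by apply: ler_peMr; [exact: ltW|rewrite ler1n /cnt big_ord_recl/= ltW].
by rewrite ltr0n /cnt big_ord_recl/= ltW.
Qed.

End conditional_share.

(** * Polarization *)

(** The right-hand sum is the permanent. Expanding the product on the left over maps f from rows to
    columns, only the sets S containing the image of f count. The alternating sum over these S
    factors over the columns, with factor -1 for a column in the image and 0 for any other, so only
    permutations survive. *)
Lemma ryser (A : comNzRingType) (k : nat) (a : 'I_k -> 'I_k -> A) :
  \sum_(S : {set 'I_k}) (-1) ^+ #|S| * \prod_i \sum_(j in S) a i j =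
  (-1) ^+ k * \sum_(s : 'S_k) \prod_i a i (s i).
Proof.
pose miss (f : {ffun 'I_k -> 'I_k}) := [set j | j \notin codom f].
transitivity (\sum_(f : {ffun 'I_k -> 'I_k})
    (\prod_(j < k) (- 1 + (j \notin codom f)%:R)) * \prod_i a i (f i)).
  under eq_bigr do rewrite bigA_distr_big mulr_sumr.
  rewrite (exchange_big_dep xpredT)//=; apply: eq_bigr => f _.
  rewrite -mulr_suml; congr (_ * _).
  rewrite bigA_distr [LHS]big_mkcond/=; apply: eq_bigr => S _.
  rewrite (bigID (mem S))/= [X in _ = X * _](eq_bigr (fun=> -1)); last first.
    by move=> j jS; rewrite jS.
  rewrite prodr_const; case: ifPn => [/ffun_onP fS|nfS].
    rewrite big1 ?mulr1// => j jS; rewrite (negbTE jS).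
    by case: (boolP (j \in codom f)) => // /codomP[i ji]; rewrite ji fS in jS.
  have /forallPn[i nSi] : ~~ [forall i, f i \in S].
    by apply: contra nfS => /forallP fS; apply/ffun_onP.
  by rewrite [X in _ * X](bigD1 (f i))//= (negbTE nSi) codom_f mul0r mulr0.
rewrite (bigID (fun f : {ffun _} => injectiveb f))/= addrC big1 ?add0r => [|f ninj].
  rewrite (reindex (@pval _)) /=; last first.
    have s0 : 'S_k := 1%g.
    by exists (insubd s0) => u /=; [rewrite valKd | move/(insubdK s0)->].
  rewrite mulr_sumr; apply: eq_big => [s|s _]; first exact: (valP s).
  rewrite (eq_bigr (fun=> -1)) ?prodr_const ?card_ord => [|j _].
    by congr (_ * _); apply: eq_bigr => i _; rewrite pvalE.
  suff -> : j \in codom (pval s) by rewrite addr0.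
  by apply/codomP; exists (s^-1%g j); rewrite pvalE permKV.
suff /existsP[j nj] : [exists j, j \notin codom f].
  rewrite (bigD1 j)//= nj addrC subrr !mul0r//.
apply: contraR ninj; rewrite negb_exists => /forallP cf.
rewrite /injectiveb /dinjectiveb; apply/card_uniqP.
rewrite [RHS]size_codom; apply: eq_card => j.
by have := cf j; rewrite negbK => ->.
Qed.

Section bounded_measurable.
Context {d : measure_display} {T : measurableType d} {R : realType}.

(** This class is stable under sums and products and integrable for a probability, which settles the
    side conditions of the signed sums used in the polarization. *)
Definition bounded_measurable (h : T -> R) :=
  measurable_fun setT h /\ exists M, forall x, `|h x| <= M.

Lemma bounded_measurable_cst c : bounded_measurable (fun=> c).
Proof. by split; [exact: measurable_cst|exists `|c|]. Qed.

Lemma bounded_measurableD g h : bounded_measurable g -> bounded_measurable h ->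
  bounded_measurable (fun x => g x + h x).
Proof.
move=> [mg [M gM]] [mh [N hN]]; split; first exact: measurable_funD.
by exists (M + N) => x; rewrite (le_trans (ler_normD _ _))// lerD.
Qed.

Lemma bounded_measurableM g h : bounded_measurable g -> bounded_measurable h ->
  bounded_measurable (fun x => g x * h x).
Proof.
move=> [mg [M gM]] [mh [N hN]]; split; first exact: measurable_funM.
by exists (M * N) => x; rewrite normrM ler_pM.
Qed.

Lemma bounded_measurable_sum (I : Type) (s : seq I) (P : pred I) (h : I -> T -> R) :
  (forall i, bounded_measurable (h i)) ->
  bounded_measurable (fun x => \sum_(i <- s | P i) h i x).
Proof.
move=> bh; elim: s => [|i s IH].
  by under eq_fun do rewrite big_nil; exact: bounded_measurable_cst.
under eq_fun do rewrite big_cons; case: (P i) => //.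
exact: bounded_measurableD.
Qed.

Lemma bounded_measurable_prod (I : Type) (s : seq I) (P : pred I) (h : I -> T -> R) :
  (forall i, bounded_measurable (h i)) ->
  bounded_measurable (fun x => \prod_(i <- s | P i) h i x).
Proof.
move=> bh; elim: s => [|i s IH].
  by under eq_fun do rewrite big_nil; exact: bounded_measurable_cst.
under eq_fun do rewrite big_cons; case: (P i) => //.
exact: bounded_measurableM.
Qed.

Lemma bounded_measurable_integrable (mu : probability T R) h :
  bounded_measurable h -> mu.-integrable setT (EFin \o h).
Proof.
move=> [mh [M hM]]; apply: measurable_bounded_integrable => //.
  by rewrite [X in (X < _)%E]probability_setT ltry.
exists M; split; first exact: num_real.
by move=> N MN x _; exact: le_trans (hM x) (ltW MN).
Qed.

Lemma Rintegral_sum (mu : probability T R) (I : Type) (s : seq I) (P : pred I)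
    (h : I -> T -> R) : (forall i, bounded_measurable (h i)) ->
  \int[mu]_x (\sum_(i <- s | P i) h i x) = \sum_(i <- s | P i) \int[mu]_x h i x.
Proof.
move=> bh; elim: s => [|i s IH].
  under eq_Rintegral do rewrite big_nil.
  by rewrite big_nil Rintegral_cst// mul0r.
under eq_Rintegral do rewrite big_cons; rewrite big_cons; case: (P i) => //.
rewrite RintegralD// ?IH//; apply: bounded_measurable_integrable => //.
exact: bounded_measurable_sum.
Qed.

End bounded_measurable.

Lemma bounded_measurable_comp {d d'} {T : measurableType d} {T' : measurableType d'}
    {R : realType} (h : T -> R) (g : T' -> T) :
  measurable_fun setT g -> bounded_measurable h -> bounded_measurable (h \o g).
Proof.
move=> mg [mh [M hM]]; split; first exact: measurableT_comp.
by exists M => x; exact: hM.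
Qed.

Lemma bounded_measurable_uniform_pdf {R : realType} (a b : R) :
  bounded_measurable (uniform_pdf a b).
Proof.
split; first exact: measurable_uniform_pdf.
exists `|(b - a)^-1| => x; rewrite /uniform_pdf; case: ifP => // _.
by rewrite normr0.
Qed.

Section polarization.
Context {R : realType} {k : nat}.
Local Notation nu := (power (unif01 R) k).
Variables (g : k.-tuple R -> R) (pi0 pi1 : R).
Hypotheses (bg : bounded_measurable g) (pi1_gt0 : 0 < pi1).
Hypothesis (pi01 : pi0 + pi1 = 1).
Hypothesis gs : forall (s : 'S_k) y, g (permt s y) = g y.

Local Notation pdf t := (uniform_pdf (0 : R) t).

Hypothesis g_mix0 : forall s : seq R, s != [::] -> {in s, forall t, 0 < t <= 1} ->
  \int[nu]_y ((\prod_(i < k) (pi0 * pdf 1 (tnth y i) +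
     pi1 * ((size s)%:R^-1 * \sum_(t <- s) pdf t (tnth y i)))) * g y) = 0.

Let L (h : k.-tuple R -> R) := \int[nu]_y (h y * g y).

Let bm (f : R -> R) i : bounded_measurable f ->
  bounded_measurable (fun y : k.-tuple R => f (tnth y i)).
Proof.
move=> bf; apply: (@bounded_measurable_comp _ _ _ _ _ f) => //.
exact: measurable_tnth.
Qed.

Let mix t x := pi0 * pdf 1 x + pi1 * pdf t x.

Let bmix t : bounded_measurable (mix t).
Proof.
by apply: bounded_measurableD; apply: bounded_measurableM;
  [exact: bounded_measurable_cst|exact: bounded_measurable_uniform_pdf|
   exact: bounded_measurable_cst|exact: bounded_measurable_uniform_pdf].
Qed.

Let L_sum (I : Type) (s : seq I) (P : pred I) (c : I -> R) (h : I -> k.-tuple R -> R) :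
  (forall i, bounded_measurable (h i)) ->
  L (fun y => \sum_(i <- s | P i) c i * h i y) = \sum_(i <- s | P i) c i * L (h i).
Proof.
move=> bh; rewrite /L.
under eq_Rintegral do rewrite mulr_suml.
rewrite Rintegral_sum.
  apply: eq_bigr => i _; rewrite -RintegralZl//.
    by apply: eq_Rintegral => y _; rewrite mulrA.
  apply: bounded_measurable_integrable; exact: bounded_measurableM.
move=> i; apply: bounded_measurableM => //.
by apply: bounded_measurableM => //; exact: bounded_measurable_cst.
Qed.

(** Symmetry of [g] together with exchangeability of the power measure. *)
Let L_permt (s : 'S_k) h : bounded_measurable h ->
  L (fun y => h (permt s y)) = L h.
Proof.
move=> bh.
have [mhg _] := bounded_measurableM bh bg.
have ih := bounded_measurable_integrable nu (bounded_measurableM bh bg).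
rewrite /L /Rintegral; congr fine.
transitivity (\int[distribution nu (permt s)]_y (h y * g y)%:E)%E; last first.
  by apply: eq_measure_integral => A mA _; exact: distribution_permt.
rewrite integral_distribution.
- by apply: eq_integral => y _ /=; rewrite gs.
- exact/measurable_EFinP.
- apply: bounded_measurable_integrable.
  apply: (@bounded_measurable_comp _ _ _ _ _ (fun y => h y * g y)) => //.
  exact: bounded_measurableM.
Qed.

(** The sum over a nonempty [S] is #|S| times a density of the form in [g_mix0], for the list of the
    [t j] with j in [S]; the factors #|S| come out as a power. *)
Let L_mix_set (t : 'I_k -> R) (S : {set 'I_k}) : (forall j, 0 < t j <= 1) ->
  L (fun y => \prod_(i < k) \sum_(j in S) mix (t j) (tnth y i)) = 0.
Proof.
move=> t01.
have [S0|[j jS]] := set_0Vmem S.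
  (* For empty [S] each factor is an empty sum, hence 0, unless there is no coordinate at all. In
     that case both products are empty, and any list in [g_mix0] gives the claim. *)
  have [k0|/prednK k0] := posnP k.
    have := @g_mix0 [:: 1] isT; rewrite /L => <-.
      apply: eq_Rintegral => y _; congr (_ * _); apply: eq_bigr => -[m mk].
      by exfalso; move: mk; rewrite [X in (_ < X)%N]k0.
    by move=> _ /[!inE] /eqP ->; rewrite ltr01 lexx.
  transitivity (\int[nu]_y (0 : R)); last by rewrite Rintegral_cst// mul0r.
  apply: eq_Rintegral => y _.
  have i0 : 'I_k by rewrite -k0; exact: ord0.
  by rewrite (bigD1 i0)//= S0 big_set0 !mul0r.
pose s := [seq t j | j <- enum S].
have sS : size s = #|S| by rewrite size_map cardE.
have S0 : #|S|%:R != 0 :> R by rewrite pnatr_eq0 -lt0n; apply/card_gt0P; exists j.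
rewrite [LHS](_ : _ = #|S|%:R ^+ k * L (fun y => \prod_(i < k)
   (pi0 * pdf 1 (tnth y i) +
     pi1 * ((size s)%:R^-1 * \sum_(t <- s) pdf t (tnth y i))))).
  rewrite /L g_mix0 ?mulr0//.
    by rewrite -size_eq0 sS -(pnatr_eq0 R).
  by move=> _ /mapP[i _ ->].
have bF : bounded_measurable (fun y => \prod_(i < k)
   (pi0 * pdf 1 (tnth y i) +
     pi1 * ((size s)%:R^-1 * \sum_(t <- s) pdf t (tnth y i)))).
  apply: bounded_measurable_prod => i.
  apply: bounded_measurableD; apply: bounded_measurableM;
    [exact: bounded_measurable_cst|
     by apply: bm; exact: bounded_measurable_uniform_pdf|
     exact: bounded_measurable_cst|].
  apply: bounded_measurableM; first exact: bounded_measurable_cst.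
  apply: bounded_measurable_sum => u.
  by apply: bm; exact: bounded_measurable_uniform_pdf.
rewrite /L -RintegralZl//; last first.
  by apply: bounded_measurable_integrable; exact: bounded_measurableM.
apply: eq_Rintegral => y _; rewrite mulrA; congr (_ * _).
have -> : #|S|%:R ^+ k = \prod_(i < k) #|S|%:R :> R by rewrite prodr_const card_ord.
rewrite -big_split/=.
apply: eq_bigr => i _.
rewrite big_split/= sumr_const -mulr_sumr sS big_map big_enum/=.
set X := \sum_(j in S) _; rewrite -[_ *+ #|S|]mulr_natl; move: (#|S|%:R) S0 => N N0.
by field.
Qed.

(** Ryser's formula turns the vanishing sums over subsets into a sum over permutations. By symmetry
    its k! terms are equal, and k! is nonzero in [R]. *)
Let L_mix (t : 'I_k -> R) : (forall j, 0 < t j <= 1) ->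
  L (fun y => \prod_(i < k) mix (t i) (tnth y i)) = 0.
Proof.
move=> t01; set h := fun y => _.
have bmixy t' i : bounded_measurable (fun y : k.-tuple R => mix t' (tnth y i)).
  exact: bm.
have bh : bounded_measurable h by exact: bounded_measurable_prod.
have : L (fun y => \sum_(S : {set 'I_k}) (-1) ^+ #|S| *
    \prod_(i < k) \sum_(j in S) mix (t j) (tnth y i)) = 0.
  rewrite L_sum; last first.
    move=> S; apply: bounded_measurable_prod => i.
    by apply: bounded_measurable_sum => j; exact: bm.
  by rewrite big1// => S _; rewrite L_mix_set// mulr0.
rewrite [X in L X](_ : _ = fun y => \sum_(s : 'S_k) (-1) ^+ k *
    h (permt s^-1%g y)); last first.
  apply/funext => y; rewrite (ryser (fun i j => mix (t j) (tnth y i))) mulr_sumr.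
  apply: eq_bigr => s _; congr (_ * _); rewrite /h.
  rewrite [RHS](reindex_inj (@perm_inj _ s))/=; apply: eq_bigr => i _.
  by rewrite tnth_mktuple permK.
rewrite L_sum; last first.
  by move=> s; apply: (@bounded_measurable_comp _ _ _ _ _ h).
under eq_bigr do rewrite L_permt//.
rewrite sumr_const -mulr_natr => /eqP; rewrite !mulf_eq0 signr_eq0/=.
by rewrite pnatr_eq0 [#|_|]card_Sn eqn0Ngt fact_gt0 orbF => /eqP.
Qed.

(** As pi0 + pi1 = 1, [mix 1] is the uniform density on [0, 1] itself, so the uniform density on
    [0, t] equals mix t / pi1 - (pi0 / pi1) mix 1. Expanding the product over the coordinates leaves
    products of mixtures in which each [t i] is kept or replaced by 1. *)
Lemma polarized_box (t : 'I_k -> R) : (forall j, 0 < t j <= 1) ->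
  \int[nu]_y ((\prod_(i < k) pdf (t i) (tnth y i)) * g y) = 0.
Proof.
move=> t01; rewrite -/(L _).
pose tJ (J : {set 'I_k}) i := if i \in J then t i else 1.
rewrite [X in L X](_ : _ = fun y => \sum_(J : {set 'I_k})
    (\prod_(i < k) (if i \in J then pi1^-1 else - (pi0 / pi1))) *
    \prod_(i < k) mix (tJ J i) (tnth y i)); last first.
  apply/funext => y.
  transitivity (\prod_(i < k) (pi1^-1 * mix (t i) (tnth y i) +
      - (pi0 / pi1) * mix 1 (tnth y i))).
    apply: eq_bigr => i _; rewrite /mix -mulrDl pi01 mul1r.
    by field; rewrite gt_eqF.
  rewrite bigA_distr; apply: eq_bigr => J _; rewrite -big_split/=.
  by apply: eq_bigr => i _; rewrite /tJ; case: ifP.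
rewrite L_sum ?big1// => [J _|J]; last first.
  by apply: bounded_measurable_prod => i; exact: bm.
rewrite L_mix ?mulr0// => j; rewrite /tJ; case: ifP => // _.
by rewrite ltr01 lexx.
Qed.

End polarization.

(** * From integrals over boxes to equality almost everywhere *)

Section boxes.
Context {R : realType} {k : nat}.
Local Notation nu := (power (unif01 R) k).

(** A pi-system generating the Borel sets; [setT] is included as the side of a box in an
    unconstrained direction. *)
Definition rays : set (set R) :=
  [set A | A = setT \/ exists x, A = `]-oo, x]%classic].

Lemma measurable_rays : measurable = <<s rays >>.
Proof.
apply/seteqP; split; last first.
  apply: smallest_sub; first exact: sigma_algebra_measurable.
  by move=> A [->|[x ->]]; [exact: measurableT|exact: measurable_itv].
have -> : (measurable : set (set R)) = (@RGenOInfty.G R).-sigma.-measurable.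
  by rewrite -RGenOInfty.measurableE.
apply: smallest_sub.
  exact: smallest_sigma_algebra.
move=> _ [x ->].
rewrite (_ : `]x, +oo[%classic = setT `\` `]-oo, x]%classic); last first.
  by rewrite setTD setCitvl.
by apply: sigma_algebraCD; apply: sub_sigma_algebra; right; exists x.
Qed.

Lemma setI_closed_rays : setI_closed rays.
Proof.
move=> A B [->|[x ->]] [->|[y ->]]; rewrite ?setTI ?setIT.
- by left.
- by right; exists y.
- by right; exists x.
right; exists (Num.min x y); apply/seteqP; split=> z /=; rewrite !in_itv/= le_min.
  by case=> -> ->.
by move=> /andP.
Qed.

Let cube : set (k.-tuple R) := rect (fun=> `[0, 1]%classic).

Let cubeC0 : nu (~` cube) = 0%E.
Proof.
have mcube : measurable cube by apply: measurable_rect.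
rewrite probability_setC// [nu cube]power_rect// big1 ?subee// => i _.
by rewrite uniform0E /uniform_prob integral_uniform_pdf1.
Qed.

Variables (G : k.-tuple R -> R) (c : R).
Hypotheses (bG : bounded_measurable G) (G0 : forall y, 0 <= G y) (c0 : 0 <= c).
Hypothesis boxG : forall t : 'I_k -> R, (forall j, 0 < t j <= 1) ->
  \int[nu]_y ((\prod_(i < k) uniform_pdf 0 (t i) (tnth y i)) * (G y - c)) = 0.

Let mG : measurable_fun setT (EFin \o G).
Proof. by apply/measurable_EFinP; case: bG. Qed.

Let iG : nu.-integrable setT (EFin \o G).
Proof. exact: bounded_measurable_integrable. Qed.

Let ic : nu.-integrable setT (EFin \o cst c).
Proof. by apply: bounded_measurable_integrable; exact: bounded_measurable_cst. Qed.

(** The product of the uniform densities is the indicator of the box divided by its volume, a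
    nonzero constant that cancels. *)
Let box_eq (t : 'I_k -> R) : (forall j, 0 < t j <= 1) ->
  (\int[nu]_(y in rect (fun i => `[0%R, t i]%classic)) (G y)%:E =
   \int[nu]_(y in rect (fun i => `[0%R, t i]%classic)) c%:E)%E.
Proof.
move=> t01; set B := rect _.
have mB : measurable B by apply: measurable_rect.
have iGB : nu.-integrable B (EFin \o G) by exact: integrableS iG.
have icB : nu.-integrable B (EFin \o cst c) by exact: integrableS ic.
rewrite -[LHS]fineK ?integrable_fin_num// -[RHS]fineK ?integrable_fin_num//.
congr EFin; apply/eqP; rewrite -subr_eq0 -RintegralB//.
have iGcB : nu.-integrable B (EFin \o (fun y => G y - c)).
  by rewrite (_ : EFin \o _ = (EFin \o G) \- (EFin \o cst c))%E//; exact: integrableB.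
have C0 : \prod_(i < k) (t i)^-1 != 0.
  by rewrite prodf_seq_neq0; apply/allP => i _ /=; rewrite invr_eq0 gt_eqF//;
    case/andP: (t01 i).
rewrite -(mulrI_eq0 _ (mulfI C0)) -RintegralZl//; apply/eqP.
rewrite Rintegral_mkcond -[RHS](boxG t01); apply: eq_Rintegral => y _.
rewrite patchE; case: ifPn => [|].
  rewrite inE => By; congr (_ * _); apply: eq_bigr => i _.
  by have := By i; rewrite /= in_itv/= /uniform_pdf subr0 => ->.
rewrite notin_setE => nBy.
have [i nAi] : exists i, ~ `[0, t i]%classic (tnth y i).
  by apply/existsNP => H; exact: nBy.
rewrite (bigD1 i)//= /uniform_pdf ifN ?mul0r//.
by apply/negP => H; apply: nAi; rewrite /= in_itv.
Qed.

(** The measures with densities [G] and [c] agree on boxes of half-lines: either some side ends at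
    or below 0 and the box is null, or its intersection with the unit cube, which carries [nu], has
    sides [0, t_i] with 0 < t_i <= 1. *)
Lemma ae_eq_of_boxes : nu [set y | G y != c] = 0%E.
Proof.
have mc : measurable_fun setT (fun _ : k.-tuple R => c%:E) by exact: measurable_cst.
have Gfin : (\int[nu]_y (EFin \o G) y < +oo)%E.
  by have /integrable_fin_num := iG; rewrite ge0_fin_numE//; first apply;
    last by apply: integral_ge0 => y _; rewrite lee_fin.
have cfin : (\int[nu]_y c%:E < +oo)%E.
  by rewrite integral_cst//= probability_setT mule1 ltry.
have G0' y : (0 <= (EFin \o G) y)%E by rewrite lee_fin.
have c0' (y : k.-tuple R) : (0 <= c%:E)%E by rewrite lee_fin.
pose m1 := density_measure mG G0' Gfin.
pose m2 := density_measure mc c0' cfin.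
have m12 E : measurable E -> m1 E = m2 E.
  move: E.
  apply: (tuple_measure_unique (G := rays)) => //.
  - exact: measurable_rays.
  - by left.
  - exact: setI_closed_rays.
  move=> A rA.
  have mA i : measurable (A i).
    by case: (rA i) => [->|[x ->]]; [exact: measurableT|exact: measurable_itv].
  have mrA : measurable (rect A) by exact: measurable_rect.
  have [[i [x [x0 Ai]]]|nul] :=
      pselect (exists i x, x <= 0 /\ A i = `]-oo, x]%classic).
    have A0 : nu (rect A) = 0%E.
      rewrite power_rect// (bigD1 i)//= Ai [X in (X * _)%E](_ : _ = 0%E) ?mul0e//.
      apply/eqP; rewrite eq_le measure_ge0 andbT.
      apply: (@le_trans _ _ (unif01 R `]-oo, 0]%classic)).
        apply: le_measure; rewrite ?inE//=; try exact: measurable_itv.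
        by apply: subitvPr; rewrite bnd_simp.
      by rewrite [X in (X <= _)%E]uniform0_ray// min_l// mul0r.
    rewrite [LHS]null_set_integral//; last exact: measurable_funTS.
    by rewrite [RHS]null_set_integral//; exact: measurable_funTS.
  have /choice[t tP] : forall i, exists t : R, 0 < t <= 1 /\
      A i `&` `[0, 1]%classic = `[0, t]%classic.
    move=> i; case: (rA i) => [->|[x Ax]].
      by exists 1; rewrite ltr01 lexx setTI.
    have x0 : 0 < x by rewrite ltNge; apply/negP => x0; apply: nul; exists i, x.
    exists (Num.min x 1); rewrite lt_min x0 ltr01 ge_min lexx orbT; split=> //.
    rewrite Ax; apply/seteqP; split=> z /=; rewrite !in_itv/= le_min.
      by move=> [-> /andP[-> ->]].
    by move=> /and3P[-> -> ->].
  have rAB : rect A `\` ~` cube = rect (fun i => `[0, t i]%classic).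
    rewrite setDE setCK rectI; congr rect; apply/funext => i.
    by case: (tP i).
  have mcubeC : measurable (~` cube) by apply: measurableC; exact: measurable_rect.
  have red (f : k.-tuple R -> \bar R) : measurable_fun setT f ->
      (forall y, 0 <= f y)%E ->
      (\int[nu]_(y in rect A) f y =
       \int[nu]_(y in rect (fun i => `[0%R, t i]%classic)) f y)%E.
    move=> mf f0; rewrite -rAB; apply: ge0_negligible_integral => //.
    exact: measurable_funTS.
  rewrite [LHS]red// [RHS]red//.
  by apply: box_eq => j; case: (tP j).
have [N [mN N0 NP]] : ae_eq nu setT (EFin \o cst c) (EFin \o G).
  by apply: integral_ae_eq => // E _ mE; rewrite [RHS](m12 E).
apply/eqP; rewrite eq_le measure_ge0 andbT -N0; apply: le_measure; rewrite ?inE//.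
  rewrite (_ : [set y | G y != c] = setT `&` G @^-1` (~` [set c])).
    by case: bG => + _; apply => //; apply: measurableC.
  by rewrite setTI; apply/seteqP; split=> y /= /eqP.
by move=> y /= /eqP Gc; apply: NP => /= H; apply: Gc; have [] := H Logic.I.
Qed.

End boxes.

(** * Independence on product spaces *)

Section independence_of_tuples.
Context {d d1 d2 : measure_display} {T : measurableType d}
  {T1 : measurableType d1} {T2 : measurableType d2} {R : realType}.
Variable P : probability T R.
Local Open Scope ereal_scope.

(** The extension takes two rounds: for a fixed box [B] both sides are finite measures in the first
    set; then, for a fixed measurable [A], they are finite measures in the second. *)
Lemma independent_pair_rect k l (X : T -> k.-tuple T1) (Y : T -> l.-tuple T2) :
  measurable_fun setT X -> measurable_fun setT Y ->
  (forall A B, (forall i, measurable (A i)) -> (forall i, measurable (B i)) ->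
    P (X @^-1` rect A `&` Y @^-1` rect B) =
    P (X @^-1` rect A) * P (Y @^-1` rect B)) ->
  independent_pair P X Y.
Proof.
move=> mX mY XY.
have mT d' (S : measurableType d') : measurable = <<s @measurable d' S >>.
  by rewrite sigma_algebra_id//; exact: sigma_algebra_measurable.
have mI d' (S : measurableType d') : setI_closed (@measurable d' S).
  exact: measurableI.
have mXA A : measurable A -> measurable (X @^-1` A).
  by move=> mA; rewrite -[X in measurable X]setTI; exact: mX.
have mYA A : measurable A -> measurable (Y @^-1` A).
  by move=> mA; rewrite -[X in measurable X]setTI; exact: mY.
pose XM := HB.pack_for {mfun T >-> k.-tuple T1} X
  (isMeasurableFun.Build _ _ _ _ _ mX).
pose YM := HB.pack_for {mfun T >-> l.-tuple T2} Y
  (isMeasurableFun.Build _ _ _ _ _ mY).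
have XYr A B : measurable A -> (forall i, measurable (B i)) ->
    P (X @^-1` A `&` Y @^-1` rect B) = P (X @^-1` A) * P (Y @^-1` rect B).
  move=> mA mB; have mYB := mYA _ (measurable_rect mB).
  have c0 : (0 <= fine (P (Y @^-1` rect B)))%R by rewrite fine_ge0.
  pose m1 := pushforward (mrestr P mYB) XM.
  pose m2 := mscale (NngNum c0) (distribution P XM).
  have : m1 A = m2 A.
    apply: (tuple_measure_unique (mT _ _) measurableT (mI _ _)) => //.
    - suff : P (X @^-1` setT `&` Y @^-1` rect B) < +oo by [].
      by rewrite preimage_setT setTI ltey_eq fin_num_measure.
    - move=> C mC; suff : P (X @^-1` rect C `&` Y @^-1` rect B) =
          (fine (P (Y @^-1` rect B)))%:E * P (X @^-1` rect C) by [].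
      by rewrite XY// muleC fineK ?fin_num_measure.
  rewrite /m1 /m2 /pushforward /mrestr /mscale/= => ->.
  by rewrite muleC fineK ?fin_num_measure.
move=> A B mA mB; have mXA' := mXA _ mA.
have c0 : (0 <= fine (P (X @^-1` A)))%R by rewrite fine_ge0.
pose m1 := pushforward (mrestr P mXA') YM.
pose m2 := mscale (NngNum c0) (distribution P YM).
have : m1 B = m2 B.
  apply: (tuple_measure_unique (mT _ _) measurableT (mI _ _)) => //.
  - suff : P (Y @^-1` setT `&` X @^-1` A) < +oo by [].
    by rewrite preimage_setT setTI ltey_eq fin_num_measure.
  - move=> C mC; suff : P (Y @^-1` rect C `&` X @^-1` A) =
        (fine (P (X @^-1` A)))%:E * P (Y @^-1` rect C) by [].
    by rewrite setIC XYr// fineK ?fin_num_measure.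
rewrite /m1 /m2 /pushforward /mrestr /mscale/= setIC => ->.
by rewrite fineK ?fin_num_measure.
Qed.

End independence_of_tuples.

Section power_coordinates.
Context {d d1 d2 : measure_display} {T : measurableType d}
  {T1 : measurableType d1} {T2 : measurableType d2} {R : realType}.
Variables (Q : probability T R) (n : nat).
Local Open Scope ereal_scope.

Lemma power_coordinate (i : 'I_n) A : measurable A ->
  power Q n ((@tnth n T ^~ i) @^-1` A) = Q A.
Proof.
move=> mA.
rewrite (_ : _ @^-1` _ = rect (fun j => if j == i then A else setT)).
  rewrite power_rect; last by move=> j; case: ifP.
  rewrite (bigD1 i)//= eqxx big1 ?mule1// => j /negbTE ->.
  exact: probability_setT.
apply/seteqP; split=> w /= wA; last by have := wA i; rewrite eqxx.
by move=> j; case: eqP => // ->.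
Qed.

Lemma power_mutually_independent (X : 'I_n -> T -> T1) :
  (forall i, measurable_fun setT (X i)) ->
  mutually_independent (power Q n) (fun i w => X i (tnth w i)).
Proof.
move=> mX J A mA.
have mXA i B : measurable B -> measurable (X i @^-1` B).
  by move=> mB; rewrite -[X in measurable X]setTI; exact: mX.
rewrite (_ : \bigcap_(i in _) _ =
    rect (fun i => if i \in J then X i @^-1` A i else setT)).
  rewrite power_rect; last by move=> i; case: ifP => // _; exact: mXA.
  rewrite [RHS]big_mkcond/=; apply: eq_bigr => i _; case: ifP => _.
    by rewrite -(power_coordinate i)//; exact: mXA.
  exact: probability_setT.
apply/seteqP; split=> w /= wA i; first by case: ifPn => // iJ; exact: wA.
by move=> iJ; have := wA i; rewrite iJ.
Qed.

Lemma power_independent_pair (X : 'I_n -> T -> T1) (Y : 'I_n -> T -> T2) :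
  (forall i, measurable_fun setT (X i)) -> (forall i, measurable_fun setT (Y i)) ->
  (forall i, independent_pair Q (X i) (Y i)) ->
  independent_pair (power Q n) (fun w => [tuple X i (tnth w i) | i < n])
    (fun w => [tuple Y i (tnth w i) | i < n]).
Proof.
move=> mX mY XY.
have mXt i : measurable_fun setT (fun w : n.-tuple T => X i (tnth w i)).
  by apply: (@measurableT_comp _ _ _ _ _ _ (X i)) => //; exact: measurable_tnth.
have mYt i : measurable_fun setT (fun w : n.-tuple T => Y i (tnth w i)).
  by apply: (@measurableT_comp _ _ _ _ _ _ (Y i)) => //; exact: measurable_tnth.
apply: independent_pair_rect; [exact: measurable_mktuple..|].
move=> A B mA mB.
have XA : (fun w => [tuple X i (tnth w i) | i < n]) @^-1` rect A =
    rect (fun i => X i @^-1` A i).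
  by apply/seteqP; split=> w /= wA i; have := wA i; rewrite tnth_mktuple.
have YB : (fun w => [tuple Y i (tnth w i) | i < n]) @^-1` rect B =
    rect (fun i => Y i @^-1` B i).
  by apply/seteqP; split=> w /= wA i; have := wA i; rewrite tnth_mktuple.
have mXA i : measurable (X i @^-1` A i).
  by rewrite -[X in measurable X]setTI; exact: mX.
have mYB i : measurable (Y i @^-1` B i).
  by rewrite -[X in measurable X]setTI; exact: mY.
rewrite XA YB rectI !power_rect//; last by move=> i; exact: measurableI.
by rewrite -big_split/=; apply: eq_bigr => i _; rewrite XY.
Qed.

End power_coordinates.

(** * Mixture models *)

Section uniform_mixture.
Context {R : realType}.

Definition mix_weight (N : nat) : {nonneg R} :=
  NngNum (divr_ge0 ler01 (ler0n R N.+1)).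

(** Equal weights are enough for the subset sums of the polarization; [N.+1] components keep the
    average nonempty. *)
Definition unif_mix (N : nat) (t : nat -> R) (t0 : forall i, 0 < t i)
    : set R -> \bar R :=
  msum (fun i => mscale (mix_weight N) (uniform0 (t0 i))) N.+1.

Variables (N : nat) (t : nat -> R).
Hypotheses (t0 : forall i, 0 < t i) (t1 : forall i, t i <= 1).
Local Notation mix := (unif_mix N t0).

HB.instance Definition _ := Measure.on mix.

Lemma unif_mix_sum A : mix A = (\sum_(i < N.+1) (N.+1%:R^-1)%:E * uniform0 (t0 i) A)%E.
Proof.
rewrite /unif_mix /msum; apply: eq_bigr => i _.
by rewrite [LHS](_ : _ = ((mix_weight N)%:num%:E * uniform0 (t0 i) A)%E)//= div1r.
Qed.

Let mixT : mix setT = 1%:E.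
Proof.
rewrite unif_mix_sum.
under eq_bigr do rewrite probability_setT mule1.
by rewrite sumEFin sumr_const card_ord -(mulr_natl _^-1) mulfV// pnatr_eq0.
Qed.

HB.instance Definition _ := Measure_isProbability.Build _ _ _ mix mixT.

Definition mix_pdf (x : R) : R :=
  N.+1%:R^-1 * \sum_(i < N.+1) uniform_pdf 0 (t i) x.

Lemma measurable_mix_pdf : measurable_fun setT mix_pdf.
Proof.
apply: measurable_funM; first exact: measurable_cst.
by apply: measurable_sum => i; exact: measurable_uniform_pdf.
Qed.

Lemma mix_pdf_ge0 x : 0 <= mix_pdf x.
Proof.
rewrite mulr_ge0// sumr_ge0// => i _; exact: uniform_pdf_ge0.
Qed.

Lemma integral_unif_mix (f : R -> \bar R) :
  measurable_fun setT f -> (forall x, 0 <= f x)%E ->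
  (\int[mix]_x f x = \int[unif01 R]_x ((mix_pdf x)%:E * f x))%E.
Proof.
move=> mf f0.
have mpdf i : measurable_fun setT
    (fun x => ((uniform_pdf 0 (t i) x)%:E * f x)%E).
  by apply: emeasurable_funM => //; apply/measurable_EFinP;
    exact: measurable_uniform_pdf.
have pdf0 i x : (0 <= (uniform_pdf 0 (t i) x)%:E * f x)%E.
  by rewrite mule_ge0// lee_fin uniform_pdf_ge0.
rewrite ge0_integral_measure_sum//.
transitivity (\sum_(i < N.+1) (N.+1%:R^-1)%:E *
    \int[unif01 R]_x ((uniform_pdf 0 (t i) x)%:E * f x))%E.
  apply: eq_bigr => i _; rewrite ge0_integral_mscale//=.
  by rewrite div1r ge0_integral_uniform0_density.
under [RHS]eq_integral => x _.
  rewrite /mix_pdf EFinM -muleA -sumEFin ge0_sume_distrl; last first.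
    by move=> i _; rewrite lee_fin uniform_pdf_ge0.
  over.
rewrite ge0_integralZl//=.
- rewrite ge0_integral_sum//= ge0_sume_distrr// => i _.
  exact: integral_ge0.
- exact: emeasurable_sum.
- by move=> x _; exact: sume_ge0.
Qed.

Lemma unif_mixE A : measurable A ->
  mix A = (\int[lebesgue_measure]_(x in A) (mix_pdf x)%:E)%E.
Proof.
move=> mA; rewrite unif_mix_sum.
under [RHS]eq_integral do rewrite /mix_pdf EFinM -sumEFin.
have mpdf i : measurable_fun (A : set (measurableTypeR R))
    (fun x => (uniform_pdf 0 (t i) x)%:E).
  by apply/measurable_EFinP/measurable_funTS; exact: measurable_uniform_pdf.
rewrite ge0_integralZl//=.
- rewrite ge0_integral_sum//=.
    rewrite ge0_sume_distrr// => i _; apply: integral_ge0 => x _.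
    by rewrite lee_fin uniform_pdf_ge0.
  by move=> i x _; rewrite lee_fin uniform_pdf_ge0.
- exact: emeasurable_sum.
- by move=> x _; apply: sume_ge0 => i _; rewrite lee_fin uniform_pdf_ge0.
Qed.

(** Each component lies above the diagonal, since min(x, t) / t >= x when x and t are at most 1.
    This is the stochastic order demanded by (C1). *)
Lemma unif_mix_ray x : 0 <= x <= 1 -> (x%:E <= mix `]-oo, x]%classic)%E.
Proof.
move=> /andP[x0 x1]; rewrite unif_mix_sum.
have -> : x%:E = (\sum_(i < N.+1) (N.+1%:R^-1)%:E * x%:E)%E.
  rewrite (eq_bigr (fun=> (N.+1%:R^-1 * x)%:E))// sumEFin sumr_const card_ord.
  by rewrite -(mulr_natl (_ * x)) mulVKf// pnatr_eq0.
apply: lee_sum => i _; apply: lee_wpmul2l; first by rewrite lee_fin.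
rewrite uniform0_ray// lee_fin ler_pdivlMr// le_min.
by rewrite ler_piMr//= ler_piMl// ltW.
Qed.

(* [bi_xi01] constrains every outcome, not almost every one. *)
Definition clip (x : R) : R := if 0 <= x <= 1 then x else 0.

Lemma clip01 x : 0 <= clip x <= 1.
Proof. by rewrite /clip; case: ifP => // _; rewrite lexx ler01. Qed.

Lemma measurable_clip : measurable_fun setT clip.
Proof.
apply: measurable_fun_ifT; [|exact: measurable_id|exact: measurable_cst].
by apply: measurable_and; apply: measurable_fun_ler => //; exact: measurable_cst.
Qed.

(** The mixture density vanishes outside [0, 1], and [clip] is the identity inside. *)
Lemma integral_unif_mix_clip (f : R -> \bar R) :
  measurable_fun setT f -> (forall x, 0 <= f x)%E ->
  (\int[mix]_x f (clip x) = \int[mix]_x f x)%E.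
Proof.
move=> mf f0; rewrite !integral_unif_mix//; last first.
  by apply: measurableT_comp => //; exact: measurable_clip.
apply: eq_integral => x _; rewrite /clip; case: ifPn => // nx.
suff -> : mix_pdf x = 0 by rewrite !mul0e.
rewrite /mix_pdf big1 ?mulr0// => i _; rewrite /uniform_pdf ifN//.
by apply: contra nx => /andP[-> /le_trans]; apply.
Qed.

Lemma unif_mix_clip A : measurable A -> mix (clip @^-1` A) = mix A.
Proof.
move=> mA.
have mcA : measurable (clip @^-1` A).
  by rewrite -[X in measurable X]setTI; exact: measurable_clip.
transitivity (\int[mix]_x (\1_A (clip x))%:E)%E.
  rewrite -[clip @^-1` A]setIT -(integral_indic mix measurableT mcA).
  by apply: eq_integral => x _; rewrite !indicE.
rewrite (integral_unif_mix_clip (f := EFin \o \1_A)).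
- by rewrite integral_indic// setIT.
- by apply/measurable_EFinP; exact: measurable_indic.
- by move=> x; rewrite lee_fin.
Qed.

End uniform_mixture.

Lemma integral_probability_cst {d} {T : measurableType d} {R : realType}
    (P : probability T R) (c : \bar R) : (\int[P]__ c = c)%E.
Proof. by rewrite integral_cst//= probability_setT mule1. Qed.

Section base.
Context {R : realType}.
Variables (p : R) (N : nat) (t : nat -> R).
Hypotheses (p01 : 0 <= p <= 1).
Hypotheses (t0 : forall i, 0 < t i) (t1 : forall i, t i <= 1).
Local Open Scope ereal_scope.

(** The data of one hypothesis: U, a Bernoulli flag that is true with probability [p], and xi. H is
    a function of the flag, chosen separately for each model. *)
Definition base : probability (R * (bool * R))%type R :=
  (unif01 R \x (bernoulli_prob p \x unif_mix N t0))%E.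

Lemma integral_base (f : R * (bool * R) -> \bar R) :
  measurable_fun setT f -> (forall w, 0 <= f w) ->
  \int[base]_w f w = \int[unif01 R]_u
    (p%:E * \int[unif_mix N t0]_x f (u, (true, x)) +
     (1 - p)%:E * \int[unif_mix N t0]_x f (u, (false, x))).
Proof.
move=> mf f0; rewrite fubini_tonelli1//; apply: eq_integral => u _.
have mfu : measurable_fun setT (fun bx => f (u, bx)) by exact: measurableT_comp.
by rewrite /fubini_F fubini_tonelli1// integral_bernoulli_prob// => b;
  exact: integral_ge0.
Qed.

Lemma measurable_base_pval (e : bool -> bool) :
  measurable_fun setT
    (fun w : R * (bool * R) => if e w.2.1 then clip w.2.2 else w.1).
Proof.
apply: measurable_fun_ifT => //.
- by apply: (@measurableT_comp _ _ _ _ _ _ e) => //; exact: measurableT_comp.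
- apply: measurableT_comp; first exact: measurable_clip.
  exact: measurableT_comp.
Qed.

Definition base_pdf (x : R) : R :=
  ((1 - p) * uniform_pdf 0 1 x + p * mix_pdf N t x)%R.

Lemma measurable_base_pdf : measurable_fun setT base_pdf.
Proof.
apply: measurable_funD; apply: measurable_funM => //.
  exact: measurable_uniform_pdf.
exact: measurable_mix_pdf.
Qed.

Lemma base_pdf_ge0 x : (0 <= base_pdf x)%R.
Proof.
case/andP: p01 => p0 p1; rewrite addr_ge0// mulr_ge0// ?subr_ge0//.
  exact: uniform_pdf_ge0.
exact: mix_pdf_ge0.
Qed.

(** There are two regimes. Either H follows the flag and the p-value is xi with probability [p] and
    U otherwise; or p = 1 and the branch of a false flag has weight zero on both sides. *)
Lemma integral_base_pval (e : bool -> bool) (f : R -> \bar R) :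
  e true -> e false = false \/ p = 1%R ->
  measurable_fun setT f -> (forall x, 0 <= f x) ->
  \int[base]_w f (if e w.2.1 then clip w.2.2 else w.1) =
  \int[unif01 R]_x ((base_pdf x)%:E * f x).
Proof.
move=> et ef mf f0; case/andP: (p01) => p0 p1.
have mfpdf (g : R -> R) : measurable_fun setT g ->
    measurable_fun setT (fun x => (g x)%:E * f x).
  by move=> mg; apply: emeasurable_funM => //; exact/measurable_EFinP.
rewrite integral_base//; last first.
  by apply: measurableT_comp => //; exact: measurable_base_pval.
rewrite /= et; under eq_integral do rewrite integral_unif_mix_clip//.
have updf : \int[unif01 R]_x f x =
    \int[unif01 R]_x ((uniform_pdf 0 1 x)%:E * f x).
  exact: ge0_integral_uniform0_density.
transitivity (\int[unif01 R]_u (p%:E * \int[unif_mix N t0]_x f x + (1 - p)%:E * f u)).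
  apply: eq_integral => u _; case: ef => [->|->]; last by rewrite subrr !mul0e.
  by rewrite integral_cst//= probability_setT mule1.
have q0 : (0 <= 1 - p)%R by rewrite subr_ge0.
have qf0 x : 0 <= (1 - p)%:E * f x by rewrite mule_ge0// lee_fin.
have mqf : measurable_fun setT (fun x => (1 - p)%:E * f x) by exact: (mfpdf (cst _)).
transitivity (\int[unif01 R]__ (p%:E * \int[unif_mix N t0]_x f x) +
    \int[unif01 R]_x ((1 - p)%:E * f x)).
  by apply: ge0_integralD => // x _; rewrite mule_ge0// integral_ge0.
rewrite [X in X + _](integral_probability_cst (unif01 R)) ge0_integralZl// updf.
have mpf1 : measurable_fun setT (fun x => (uniform_pdf 0 1 x)%:E * f x).
  by apply: mfpdf; exact: measurable_uniform_pdf.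
have mpf2 : measurable_fun setT (fun x => (mix_pdf N t x)%:E * f x).
  by apply: mfpdf; exact: measurable_mix_pdf.
have pf1 x : 0 <= (uniform_pdf 0 1 x)%:E * f x.
  by rewrite mule_ge0// lee_fin uniform_pdf_ge0.
have pf2 x : 0 <= (mix_pdf N t x)%:E * f x.
  by rewrite mule_ge0// lee_fin mix_pdf_ge0.
rewrite integral_unif_mix// -!ge0_integralZl//.
transitivity (\int[unif01 R]_x (p%:E * ((mix_pdf N t x)%:E * f x) +
    (1 - p)%:E * ((uniform_pdf 0 1 x)%:E * f x))).
  apply/esym/ge0_integralD => //.
  - by move=> x _; rewrite mule_ge0.
  - exact: emeasurable_funM.
  - by move=> x _; rewrite mule_ge0.
  - exact: emeasurable_funM.
apply: (@eq_integral _ _ _ (unif01 R)) => x _.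
rewrite /base_pdf; move: (mix_pdf_ge0 N t0 x) (uniform_pdf_ge0 x (@ltr01 R)) q0.
move: (mix_pdf N t x) (uniform_pdf 0 1 x) (1 - p)%R => a b q a0 b0 q1.
by rewrite EFinD ge0_muleDl ?lee_fin ?mulr_ge0// addeC !EFinM !muleA.
Qed.

End base.

(** The one-dimensional change of variables is applied coordinate by coordinate, by Tonelli and
    induction. *)
Lemma integral_power_map {d d'} {T : measurableType d} {T' : measurableType d'}
    {R : realType} (Q : probability T R) (mu : probability T' R)
    (z : T -> T') (f : T' -> \bar R) (k : nat) (g : k.-tuple T' -> \bar R) :
  measurable_fun setT z -> measurable_fun setT f -> (forall x, 0 <= f x)%E ->
  (forall h : T' -> \bar R, measurable_fun setT h -> (forall x, 0 <= h x)%E ->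
    \int[Q]_w h (z w) = \int[mu]_x (f x * h x))%E ->
  measurable_fun setT g -> (forall y, 0 <= g y)%E ->
  (\int[power Q k]_t g [tuple z (tnth t i) | i < k] =
   \int[power mu k]_y ((\prod_(i < k) f (tnth y i)) * g y))%E.
Proof.
move=> mz mf f0 zf; elim: k g => [|k IH] g mg g0.
  have tE (S : Type) (a b : 0.-tuple S) : a = b by rewrite (tuple0 a) (tuple0 b).
  have gE y : g y = g [tuple] by congr g; exact: tE.
  under eq_integral do rewrite gE.
  under [RHS]eq_integral do rewrite big_ord0 mul1e gE.
  by rewrite !integral_probability_cst.
have mZ j : measurable_fun setT
    (fun t : j.-tuple T => [tuple z (tnth t i) | i < j]).
  apply: measurable_mktuple => i.
  by apply: (@measurableT_comp _ _ _ _ _ _ z) => //; exact: measurable_tnth.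
have mprod j : measurable_fun setT
    (fun y : j.-tuple T' => (\prod_(i < j) f (tnth y i))%E).
  by apply: (@measurable_bigprod _ _ _ _ _ _ (fun=> f) (fun i t => tnth t i)) => // i;
    exact: measurable_tnth.
have prod0 j (y : j.-tuple T') : (0 <= \prod_(i < j) f (tnth y i))%E.
  by apply: prode_ge0.
rewrite ge0_integral_power; last 2 first.
- exact: (measurableT_comp mg (mZ _)).
- by move=> t; exact: g0.
pose h x := (\int[power mu k]_y ((\prod_(i < k) f (tnth y i)) * g (ucons (x, y))))%E.
have mgu x : measurable_fun setT (fun y => g (ucons (x, y))).
  apply: (@measurableT_comp _ _ _ _ _ _ g) => //.
  exact: (measurableT_comp (@measurable_ucons _ _ _)).
transitivity (\int[Q]_x h (z x))%E.
  apply: eq_integral => x _; rewrite /h -(IH (fun y => g (ucons (z x, y))))//.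
  apply: eq_integral => t _; congr g; apply: eq_from_tnth => i.
  rewrite tnth_mktuple; case: (unliftP ord0 i) => [j ->|->//].
  by rewrite !tnthS tnth_mktuple.
have mh : measurable_fun setT h.
  apply: (@measurable_fun_fubini_tonelli_F _ _ _ _ _ _
    (fun xy => (\prod_(i < k) f (tnth xy.2 i)) * g (ucons xy))%E).
    apply: emeasurable_funM; first exact: (measurableT_comp (mprod k) measurable_snd).
    exact: (measurableT_comp mg (@measurable_ucons _ _ _)).
  by move=> xy; rewrite mule_ge0.
rewrite zf//; last by move=> x; apply: integral_ge0 => y _; rewrite mule_ge0.
rewrite ge0_integral_power; last 2 first.
- exact: (emeasurable_funM (mprod _) mg).
- by move=> y; rewrite mule_ge0.
apply: eq_integral => x _; rewrite /h -ge0_integralZl//.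
- apply: eq_integral => y _; rewrite big_ord_recl muleA; congr (_ * _ * _)%E.
  by apply: eq_bigr => i _; rewrite tnthS.
- exact: (emeasurable_funM (mprod _) (mgu x)).
- by move=> y _; rewrite mule_ge0.
Qed.

Lemma ge0_integral_power_coordinate {d} {T : measurableType d} {R : realType}
    (Q : probability T R) n (i : 'I_n) (f : T -> \bar R) :
  measurable_fun setT f -> (forall x, 0 <= f x)%E ->
  (\int[power Q n]_w f (tnth w i) = \int[Q]_x f x)%E.
Proof.
move=> mf f0.
have := @ge0_integral_power_prod _ _ _ Q n (fun j => if j == i then f else cst 1%E).
rewrite (bigD1 i)//= eqxx big1 ?mule1 => [<-|j /negbTE ->].
- apply: eq_integral => w _; rewrite (bigD1 i)//= eqxx big1 ?mule1// => j /negbTE.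
  by move=> ->.
- by move=> j; case: ifP => // _; exact: measurable_cst.
- by move=> j x; case: ifP.
- exact: integral_probability_cst.
Qed.

(** * Realization of the Basic Independence Model on a power space *)

Section model.
Context {R : realType} {k : nat}.
Variables (p : R) (N : nat) (t : nat -> R) (e0 e1 : bool -> bool).
Hypotheses (p01 : 0 <= p <= 1).
Hypotheses (t0 : forall i, 0 < t i) (t1 : forall i, t i <= 1).
Local Notation n := k.+1.
Local Notation T0 := (R * (bool * R))%type.
Local Notation Q := (base p N t0).
Local Notation P := (power Q n).

(* The model of (a) is [e0 = e1 = id] with Bernoulli parameter [p = 1 - pi0]; the
   model of (b) is [e0 = xpred0], [e1 = xpredT] with [p = 1]. *)
Definition null_flag (i : 'I_n) : bool -> bool := if i == ord0 then e0 else e1.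

Definition mdl_H (i : 'I_n) (w : n.-tuple T0) : bool := null_flag i (tnth w i).2.1.
Definition mdl_xi (i : 'I_n) (w : n.-tuple T0) : R := clip (tnth w i).2.2.
Definition mdl_U (i : 'I_n) (w : n.-tuple T0) : R := (tnth w i).1.

Let mflag (e : bool -> bool) : measurable_fun setT (fun x : T0 => e x.2.1).
Proof. by apply: (@measurableT_comp _ _ _ _ _ _ e) => //; exact: measurableT_comp. Qed.

Let mxi0 : measurable_fun setT (fun x : T0 => clip x.2.2).
Proof.
apply: measurableT_comp; first exact: measurable_clip.
exact: measurableT_comp.
Qed.

Lemma measurable_mdl_H i : measurable_fun setT (mdl_H i).
Proof.
apply: (@measurableT_comp _ _ _ _ _ _ (fun x : T0 => null_flag i x.2.1)) => //.
exact: measurable_tnth.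
Qed.

Lemma measurable_mdl_xi i : measurable_fun setT (mdl_xi i).
Proof.
apply: (@measurableT_comp _ _ _ _ _ _ (fun x : T0 => clip x.2.2)) => //.
exact: measurable_tnth.
Qed.

Lemma measurable_mdl_U i : measurable_fun setT (mdl_U i).
Proof.
apply: (@measurableT_comp _ _ _ _ _ _ (@fst R (bool * R))) => //.
exact: measurable_tnth.
Qed.

HB.instance Definition _ i :=
  isMeasurableFun.Build _ _ _ _ (mdl_H i) (measurable_mdl_H i).
HB.instance Definition _ i :=
  isMeasurableFun.Build _ _ _ _ (mdl_xi i) (measurable_mdl_xi i).
HB.instance Definition _ i :=
  isMeasurableFun.Build _ _ _ _ (mdl_U i) (measurable_mdl_U i).

Let Q_rect A B C : measurable A -> measurable B -> measurable C ->
  (Q (A `*` (B `*` C)) = unif01 R A * (bernoulli_prob p B * unif_mix N t0 C))%E.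
Proof.
move=> mA mB mC; rewrite /base [LHS]product_measure1E//; last exact: measurableX.
by rewrite [X in (_ * X)%E]product_measure1E.
Qed.

Lemma mdl_xi01 i w : 0 <= mdl_xi i w <= 1.
Proof. exact: clip01. Qed.

Lemma mdl_U_unif i (A : set R) : measurable A ->
  distribution P (mdl_U i) A = uniform_prob (@ltr01 R) A.
Proof.
move=> mA.
have mA' : measurable (A `*` (setT `*` setT) : set T0).
  by apply: measurableX => //; exact: measurableX.
transitivity (P ((@tnth n T0 ^~ i) @^-1` (A `*` (setT `*` setT)))).
  congr (P _); apply/seteqP; split=> w //=.
  by case.
by rewrite power_coordinate// Q_rect//= !probability_setT !mule1.
Qed.

Lemma mdl_xi_dist i (A : set R) : measurable A ->
  distribution P (mdl_xi i) A = unif_mix N t0 A.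
Proof.
move=> mA; rewrite -[RHS](unif_mix_clip _ t0 t1 mA).
have mcA : measurable (@clip R @^-1` A).
  by rewrite -[X in measurable X]setTI; exact: measurable_clip.
have mA' : measurable (setT `*` (setT `*` (@clip R @^-1` A)) : set T0).
  by apply: measurableX => //; exact: measurableX.
transitivity (P ((@tnth n T0 ^~ i) @^-1` (setT `*` (setT `*` (@clip R @^-1` A))))).
  congr (P _); apply/seteqP; split=> w //=.
  by case=> _ [].
by rewrite power_coordinate// Q_rect//= !probability_setT !mul1e.
Qed.

Lemma mdl_U_indep : mutually_independent P mdl_U.
Proof.
by apply: (@power_mutually_independent _ _ _ _ _ Q n (fun=> fst)).
Qed.

Lemma mdl_xi_indep : mutually_independent P mdl_xi.
Proof.
by apply: (@power_mutually_independent _ _ _ _ _ Q n (fun _ x => clip x.2.2)).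
Qed.

Lemma mdl_H_indep : mutually_independent P mdl_H.
Proof.
by apply: (@power_mutually_independent _ _ _ _ _ Q n (fun i x => null_flag i x.2.1)).
Qed.

Lemma mdl_indep_Hxi : independent_pair P
  (fun w => [tuple mdl_U i w | i < n])
  (fun w => [tuple (mdl_H i w, mdl_xi i w) | i < n]).
Proof.
have mHx i : measurable_fun setT (fun x : T0 => (null_flag i x.2.1, clip x.2.2)).
  exact: measurable_fun_pair.
apply: (@power_independent_pair _ _ _ _ _ _ _ Q n (fun=> fst)
  (fun i x => (null_flag i x.2.1, clip x.2.2))) => // i A B mA mB.
set C := (fun bx : bool * R => (null_flag i bx.1, clip bx.2)) @^-1` B.
have mC : measurable C.
  rewrite -[X in measurable X]setTI.
  suff : measurable_fun setT
    (fun bx : bool * R => (null_flag i bx.1, clip bx.2)) by apply.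
  apply: measurable_fun_pair.
    by apply: (@measurableT_comp _ _ _ _ _ _ (null_flag i)).
  by apply: (@measurableT_comp _ _ _ _ _ _ (@clip R)) => //; exact: measurable_clip.
have -> : fst @^-1` A = A `*` setT :> set T0.
  by apply/seteqP; split=> x //= [].
have -> : (fun x : T0 => (null_flag i x.2.1, clip x.2.2)) @^-1` B = setT `*` C.
  by apply/seteqP; split=> x //= [].
rewrite -setXI setTI setIT /base [LHS]product_measure1E//.
rewrite [X in _ = (X * _)%E]product_measure1E//.
rewrite [X in _ = (_ * X)%E]product_measure1E//.
rewrite [X in _ = (_ * X * _)%E](_ : _ = 1%E); last exact: probability_setT.
rewrite [X in _ = (_ * (X * _))%E](_ : _ = 1%E); last exact: probability_setT.
by rewrite mule1 mul1e.
Qed.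

Lemma mdl_H_xi_indep : independent_pair P
  (fun w => [tuple mdl_H i w | i < n])
  (fun w => [tuple mdl_xi i w | i < n]).
Proof.
apply: (@power_independent_pair _ _ _ _ _ _ _ Q n (fun i x => null_flag i x.2.1)
  (fun _ x => clip x.2.2)) => // i A B mA mB.
set A' := null_flag i @^-1` A; set B' := @clip R @^-1` B.
have mB' : measurable B'.
  by rewrite -[X in measurable X]setTI; exact: measurable_clip.
have mA' : measurable A' by [].
have -> : (fun x : T0 => null_flag i x.2.1) @^-1` A = setT `*` (A' `*` setT).
  by apply/seteqP; split=> x //= [_ []].
have -> : (fun x : T0 => clip x.2.2) @^-1` B = setT `*` (setT `*` B').
  by apply/seteqP; split=> x //= [_ []].
rewrite -setXI setTI -setXI setTI setIT !Q_rect//.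
by rewrite !probability_setT !mul1e mule1.
Qed.

(** The probability of H = 0 when H is [e] applied to the flag. *)
Definition flag_mass (e : bool -> bool) : R :=
  p * (~~ e true)%:R + (1 - p) * (~~ e false)%:R.

Lemma flag_mass_ge0 e : 0 <= flag_mass e.
Proof.
by case/andP: p01 => p0 p1; rewrite addr_ge0// mulr_ge0// subr_ge0.
Qed.

Lemma integral_flag (e : bool -> bool) :
  (\int[Q]_x (~~ e x.2.1)%:R%:E = (flag_mass e)%:E)%E.
Proof.
rewrite integral_base//=.
- under eq_integral do rewrite !integral_probability_cst.
  by rewrite integral_probability_cst.
- apply/measurable_EFinP; apply: measurable_natr_bool.
  exact: (@mflag (fun b => ~~ e b)).
Qed.

Definition mdl_EN0 : R := \sum_(i < n) flag_mass (null_flag i).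

Lemma mdl_EN0E :
  ('E_P[fun w => (\sum_(i < n) ~~ mdl_H i w)%N%:R] = mdl_EN0%:E)%E.
Proof.
rewrite unlock.
under eq_integral do rewrite natr_sum -sumEFin.
rewrite ge0_integral_sum//=.
- rewrite /mdl_EN0 -sumEFin; apply: eq_bigr => i _; rewrite -integral_flag.
  rewrite -(ge0_integral_power_coordinate _ i)//.
  apply/measurable_EFinP; apply: measurable_natr_bool.
  exact: (@mflag (fun b => ~~ null_flag i b)).
- move=> i; apply/measurable_EFinP; apply: measurable_natr_bool.
  by apply: measurable_neg; exact: measurable_mdl_H.
Qed.

Hypothesis EN0_gt0 : 0 < mdl_EN0.

Lemma mdl_EN0_gt0 : ('E_P[fun w => (\sum_(i < n) ~~ mdl_H i w)%N%:R] > 0)%E.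
Proof. by rewrite mdl_EN0E lte_fin. Qed.

Definition mdl : BI_model R n := Build_BI_model
  (bi_H := mdl_H) mdl_xi01 mdl_U_unif mdl_U_indep mdl_indep_Hxi mdl_EN0_gt0.

Lemma mdl_C1 : C1 mdl.
Proof.
split; first exact: mdl_xi_indep.
exists (mix_pdf N t); split.
- exact: measurable_mix_pdf.
- exact: mix_pdf_ge0.
- move=> i A mA; rewrite -(unif_mixE N t0)//; exact: mdl_xi_dist.
- move=> i x x01; rewrite /cdf [X in (_ <= X)%E](mdl_xi_dist i)//.
  exact: unif_mix_ray.
Qed.

End model.

(** * The FDR in the realized models *)

Section model_FDR.
Context {R : realType} {k : nat}.
Variables (p : R) (N : nat) (t : nat -> R) (e0 e1 : bool -> bool).
Hypotheses (p01 : 0 <= p <= 1).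
Hypotheses (t0 : forall i, 0 < t i) (t1 : forall i, t i <= 1).
Variables (alpha0 lambda : R) (n0hat : (R -> R) -> R).
Hypotheses (alpha0_gt0 : 0 < alpha0) (lambda_gt0 : 0 < lambda).
Hypothesis lambda_lt1 : lambda < 1.
Hypothesis (n0_gt0 : forall f, 0 < n0hat f).
Hypothesis mn0 : tail_measurable lambda n0hat.
Hypotheses (e1t : e1 true) (e1f : e1 false = false \/ p = 1).
Local Notation n := k.+1.
Local Notation T0 := (R * (bool * R))%type.
Local Notation Q := (base p N t0).
Local Notation P := (power Q n).

Let z (x : T0) : R := if e1 x.2.1 then clip x.2.2 else x.1.

Definition mdl_pval (w : n.-tuple T0) (i : 'I_n) : R :=
  if mdl_H e0 e1 i w then mdl_xi i w else mdl_U i w.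

Let share (i : 'I_n) (w : n.-tuple T0) : R :=
  (~~ mdl_H e0 e1 i w)%:R * adaptive_share alpha0 lambda n0hat (mdl_pval w) i.

Let share_ge0 i w : 0 <= share i w.
Proof. by rewrite mulr_ge0// adaptive_share_ge0. Qed.

Lemma measurable_mdl_pval i : measurable_fun setT (mdl_pval ^~ i).
Proof.
apply: measurable_fun_ifT; [exact: measurable_mdl_H|exact: measurable_mdl_xi|].
exact: measurable_mdl_U.
Qed.

Let mshare i : measurable_fun setT (share i).
Proof.
apply: measurable_funM.
  by apply: measurable_natr_bool; apply: measurable_neg; exact: measurable_mdl_H.
by apply: measurable_adaptive_share => // j; exact: measurable_mdl_pval.
Qed.

Definition mean_share : \bar R :=
  (\int[power (unif01 R) k]_y
     ((\prod_(j < k) base_pdf p N t (tnth y j)) * cond_share alpha0 lambda n0hat y)%:E)%E.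

Let cs := @cond_share R k alpha0 lambda n0hat.

Let mcs : measurable_fun setT cs.
Proof. exact: measurable_cond_share. Qed.

Let cs0 y : 0 <= cs y.
Proof. exact: cond_share_ge0. Qed.

Let mz : measurable_fun setT z.
Proof. exact: measurable_base_pval. Qed.

Let integral_z (f : k.-tuple R -> \bar R) :
  measurable_fun setT f -> (forall y, 0 <= f y)%E ->
  (\int[power Q k]_v f [tuple z (tnth v i) | i < k] =
   \int[power (unif01 R) k]_y
     ((\prod_(j < k) base_pdf p N t (tnth y j))%:E * f y))%E.
Proof.
move=> mf f0.
rewrite (@integral_power_map _ _ _ _ _ _ (unif01 R) z (EFin \o base_pdf p N t))//.
- by apply: eq_integral => y _; rewrite prodEFin.
- by apply/measurable_EFinP; exact: measurable_base_pdf.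
- by move=> x; rewrite lee_fin base_pdf_ge0.
- by move=> h mh h0; exact: integral_base_pval.
Qed.

Lemma mean_share_cst :
  (\int[power (unif01 R) k]_y (\prod_(j < k) base_pdf p N t (tnth y j))%:E = 1)%E.
Proof.
have := integral_z (f := cst 1%E); rewrite integral_probability_cst => -> //.
by apply: eq_integral => y _; rewrite mule1.
Qed.

(** Given the data of the other hypotheses, the flag and U of [ord0] are still independent: the flag
    contributes its mass, and U integrates the share to [cond_share]. *)
Let integral_share0 :
  (\int[P]_w (share ord0 w)%:E = (flag_mass p e0)%:E * mean_share)%E.
Proof.
rewrite ge0_integral_power_swap; last 2 first.
- by apply/measurable_EFinP; exact: mshare.
- by move=> w; rewrite lee_fin.
pose Z (v : k.-tuple T0) := [tuple z (tnth v i) | i < k].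
transitivity (\int[power Q k]_v ((flag_mass p e0)%:E * (cs (Z v))%:E))%E.
  apply: eq_integral => v _.
  have shareE x : share ord0 (ucons (x, v)) = (~~ e0 x.2.1)%:R *
      adaptive_share alpha0 lambda n0hat (tnth (ucons (x.1, Z v))) ord0.
    rewrite /share /mdl_H /null_flag eqxx [tnth _ _]/=.
    case: (boolP (e0 x.2.1)) => [|ne0]; first by rewrite !mul0r.
    congr (_ * adaptive_share _ _ _ _ _); apply/funext => i.
    case: (unliftP ord0 i) => [j ->|->].
      rewrite /mdl_pval /mdl_H /mdl_xi /mdl_U /null_flag -[lift _ _ == _]/false.
      by rewrite !tnthS tnth_mktuple.
    by rewrite /mdl_pval /mdl_H /mdl_U /null_flag eqxx/= (negbTE ne0).
  under eq_integral do rewrite shareE.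
  pose S u := adaptive_share alpha0 lambda n0hat (tnth (ucons (u, Z v))) ord0.
  have mS : measurable_fun setT S.
    apply: measurable_adaptive_share => // i.
    case: (unliftP ord0 i) => [j ->|->]; last exact: measurable_id.
    rewrite (_ : (fun u => _) = cst (tnth (Z v) j)); first exact: measurable_cst.
    by apply/funext => u; rewrite tnthS.
  have S0 u : 0 <= S u by exact: adaptive_share_ge0.
  rewrite (integral_base N p01 t0
    (f := fun x => ((~~ e0 x.2.1)%:R * S x.1)%:E))//; last 2 first.
  - apply/measurable_EFinP; apply: measurable_funM.
      apply: measurable_natr_bool.
      by apply: (@measurableT_comp _ _ _ _ _ _ (fun b => ~~ e0 b)) => //;
        exact: measurableT_comp.
    exact: (measurableT_comp mS measurable_fst).
  - by move=> x; rewrite lee_fin mulr_ge0.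
  transitivity (\int[unif01 R]_u ((flag_mass p e0)%:E * (S u)%:E))%E.
    apply: eq_integral => u _; rewrite /= !integral_probability_cst.
    by rewrite -!EFinM -EFinD; congr EFin; rewrite /flag_mass; ring.
  rewrite ge0_integralZl//=.
  - by rewrite /S integral_adaptive_share.
  - exact/measurable_EFinP.
  - by move=> u _; rewrite lee_fin.
  - by rewrite lee_fin; exact: flag_mass_ge0.
rewrite ge0_integralZl//=.
- rewrite (integral_z (f := EFin \o cs)).
  + by congr (_ * _)%E; apply: eq_integral => y _; rewrite EFinM.
  + exact/measurable_EFinP.
  + by move=> y; rewrite lee_fin.
- apply/measurable_EFinP; apply: (measurableT_comp mcs).
  apply: measurable_mktuple => i.
  by apply: (@measurableT_comp _ _ _ _ _ _ z) => //; exact: measurable_tnth.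
- by move=> v _; rewrite lee_fin.
- exact: flag_mass_ge0.
Qed.

Hypothesis e01 : e0 =1 e1 \/ (forall b, e1 b).

(** If all flag maps coincide, the transposition of [ord0] and [i] preserves the measure and reduces
    the claim to [ord0]. If the other hypotheses are never true, both sides vanish for them. *)
Let integral_share i :
  (\int[P]_w (share i w)%:E = (flag_mass p (null_flag e0 e1 i))%:E * mean_share)%E.
Proof.
have [->|i0] := eqVneq i ord0; first by rewrite integral_share0 /null_flag eqxx.
case: e01 => [e01'|e1T]; last first.
  have -> : flag_mass p (null_flag e0 e1 i) = 0.
    by rewrite /flag_mass /null_flag (negbTE i0) !e1T !mulr0 addr0.
  rewrite mul0e integral0_eq// => w _.
  by rewrite /share /mdl_H /null_flag (negbTE i0) e1T mul0r.
have fl j : null_flag e0 e1 j =1 e0.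
  by move=> b; rewrite /null_flag; case: eqP => // _; rewrite e01'.
have -> : flag_mass p (null_flag e0 e1 i) = flag_mass p e0.
  by rewrite /flag_mass !fl.
rewrite -integral_share0.
rewrite -(ge0_integral_power_permt Q (tperm ord0 i) (f := EFin \o share ord0)).
- apply: eq_integral => w _ /=; rewrite /share.
  have flw j : mdl_H e0 e1 j (permt (tperm ord0 i) w) =
      mdl_H e0 e1 (tperm ord0 i j) w.
    by rewrite /mdl_H !fl tnth_mktuple.
  rewrite flw tpermL; congr (_ * _)%:E.
  rewrite (@adaptive_share_perm _ _ alpha0 lambda n0hat (mdl_pval w)
    (mdl_pval (permt (tperm ord0 i) w)) (tperm ord0 i) ord0) ?tpermL// => j.
  by rewrite /mdl_pval flw /mdl_xi /mdl_U tnth_mktuple.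
- exact/measurable_EFinP.
- by move=> w; rewrite lee_fin.
Qed.

Hypothesis EN0_gt0 : 0 < @mdl_EN0 R k p e0 e1.
Local Notation M := (mdl N p01 t0 EN0_gt0).

Lemma pval_mdl w : @Defs.pval _ _ M w = mdl_pval w.
Proof.
apply/funext => i; rewrite /Defs.pval /mdl_pval/=; case: (mdl_H e0 e1 i w) => /=.
  by rewrite subrr mul0r add0r mul1r.
by rewrite subr0 mul1r mul0r addr0.
Qed.

(** The mean share is common to all hypotheses, so summing the flag masses factors out E(N_0). *)
Lemma FDR_mdl : FDR (adaptive_crit alpha0 lambda n0hat) M =
  ((@mdl_EN0 R k p e0 e1)%:E * mean_share)%E.
Proof.
rewrite /FDR unlock.
transitivity (\int[P]_w \sum_(i < n) (share i w)%:E)%E.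
  apply: eq_integral => w _; rewrite FDPE pval_mdl sumEFin; congr EFin.
rewrite ge0_integral_sum//=.
- under eq_bigr do rewrite integral_share.
  rewrite /mdl_EN0 -sumEFin ge0_sume_distrl// => i _.
  by rewrite lee_fin flag_mass_ge0.
- by move=> i; exact/measurable_EFinP.
- by move=> i w _; rewrite lee_fin.
Qed.

End model_FDR.

(** * Identification of the critical values *)

Section completeness.
Context {R : realType} {k : nat}.
Variables (alpha0 lambda : R) (n0hat : (R -> R) -> R).
Hypotheses (alpha0_gt0 : 0 < alpha0) (lambda_gt0 : 0 < lambda).
Hypothesis (n0_gt0 : forall f, 0 < n0hat f).
Hypothesis mn0 : tail_measurable lambda n0hat.
Local Notation nu := (power (unif01 R) k).
Local Notation cs := (@cond_share R k alpha0 lambda n0hat).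

Lemma cond_share_permt (s : 'S_k) y : cs (permt s y) = cs y.
Proof.
have yE i : tnth (ucons (0 : R, permt s y)) i =
    tnth (ucons (0 : R, y)) (lift_perm ord0 ord0 s i).
  case: (unliftP ord0 i) => [j ->|->]; last by rewrite lift_perm_id.
  by rewrite lift_perm_lift !tnthS tnth_mktuple.
by rewrite /cond_share (eq_slope_perm _ _ yE) (eq_cnt_perm _ yE).
Qed.

Lemma bounded_measurable_cond_share : bounded_measurable cs.
Proof.
split; first exact: measurable_cond_share.
by exists lambda => y; rewrite ger0_norm ?cond_share_ge0// cond_share_le.
Qed.

(** The product densities have total mass 1, so a mean share of [c] for every mixture says that
    [cs - c] integrates to 0 against each of them, which is the input of the polarization. *)
Lemma cond_share_eq_ae (p c : R) : 0 < p <= 1 -> 0 <= c ->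
  (forall N (t : nat -> R), (forall i, 0 < t i) -> (forall i, t i <= 1) ->
    @mean_share R k p N t alpha0 lambda n0hat = c%:E) ->
  nu [set y | cs y != c] = 0%E.
Proof.
move=> /andP[p0 p1] c0 mean_c.
have bcs := bounded_measurable_cond_share.
have bg : bounded_measurable (fun y => cs y - c).
  by apply: bounded_measurableD => //; exact: (bounded_measurable_cst (- c)).
apply: ae_eq_of_boxes => // [y|t t01]; first exact: cond_share_ge0.
apply: (polarized_box (pi0 := 1 - p) bg p0) => //.
- by rewrite subrK.
- by move=> s y; rewrite cond_share_permt.
move=> s s0 s01.
(* The default value 1 keeps the entries of [u] beyond the end of the list in ]0, 1]. *)
pose N := (size s).-1; pose u i := nth 1 s i.
have sN : size s = N.+1 by rewrite prednK// lt0n size_eq0.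
have u01 i : 0 < u i <= 1.
  have [si|si] := ltnP i (size s); first exact/s01/mem_nth.
  by rewrite /u nth_default// ltr01 lexx.
have u0 i : 0 < u i by case/andP: (u01 i).
have u1 i : u i <= 1 by case/andP: (u01 i).
have pdfE x : (1 - p) * uniform_pdf (0 : R) 1 x +
    p * ((size s)%:R^-1 * \sum_(t <- s) uniform_pdf 0 t x) = base_pdf p N u x.
  by rewrite /base_pdf /mix_pdf (big_nth 1) big_mkord sN.
pose F (y : k.-tuple R) := \prod_(i < k) base_pdf p N u (tnth y i).
have bF : bounded_measurable F.
  apply: bounded_measurable_prod => i.
  apply: (@bounded_measurable_comp _ _ _ _ _ (base_pdf p N u)).
    exact: measurable_tnth.
  apply: bounded_measurableD; apply: bounded_measurableM;
    [exact: bounded_measurable_cst|exact: bounded_measurable_uniform_pdf|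
     exact: bounded_measurable_cst|].
  apply: bounded_measurableM; first exact: bounded_measurable_cst.
  by apply: bounded_measurable_sum => j; exact: bounded_measurable_uniform_pdf.
transitivity (\int[nu]_y (F y * cs y - c * F y)).
  apply: eq_Rintegral => y _; rewrite mulrBr (mulrC _ c).
  by congr (_ * _ - _ * _); apply: eq_bigr => i _; rewrite pdfE.
have bFc : bounded_measurable (fun y => c * F y).
  by apply: bounded_measurableM => //; exact: bounded_measurable_cst.
rewrite RintegralB//; last 2 first.
- by apply: bounded_measurable_integrable; exact: bounded_measurableM.
- exact: bounded_measurable_integrable.
rewrite RintegralZl//; last exact: bounded_measurable_integrable.
have -> : \int[nu]_y (F y * cs y) = c by rewrite /Rintegral [X in fine X](mean_c N u).
have p01 : 0 <= p <= 1 by rewrite ltW.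
have -> : \int[nu]_y F y = 1.
  by rewrite /Rintegral [X in fine X](@mean_share_cst _ _ _ N _ id p01 u0 u1)//; left.
by rewrite mulr1 subrr.
Qed.

(** The box where the other p-values are all at most [lambda] has positive measure, so it contains
    some [y] with [cs y = c]. There the count is [k.+1], and the second term of the minimum bounds
    [c]. *)
Lemma cond_share_le_size (c : R) : nu [set y | cs y != c] = 0%E ->
  c <= lambda / k.+1%:R.
Proof.
move=> csc.
pose B : set (k.-tuple R) := rect (fun=> `]-oo, lambda]%classic).
have mB : measurable B by exact: measurable_rect.
have B0 : (0 < nu B)%E.
  rewrite [X in (_ < X)%E]power_rect//.
  rewrite (eq_bigr (fun=> (Num.min lambda 1 / 1)%:E)); last first.
    by move=> i _; apply: uniform0_ray; exact: ltW.
  rewrite prodEFin prodr_const lte_fin exprn_gt0// divr1 lt_min lambda_gt0.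
  exact: ltr01.
have [y By csy] : exists2 y, B y & cs y = c.
  apply: contrapT => nBc; move: B0; apply/negP; rewrite -leNgt -csc.
  apply: le_measure; rewrite ?inE//; last first.
    by move=> y By /=; apply/eqP => csy; apply: nBc; exists y.
  rewrite (_ : [set y | cs y != c] = setT `&` cs @^-1` (~` [set c])).
    by apply: (proj1 bounded_measurable_cond_share) => //; apply: measurableC.
  by rewrite setTI; apply/seteqP; split=> y /= /eqP.
rewrite -csy /cond_share ge_min; apply/orP; right.
suff -> : cnt (tnth (ucons (0 : R, y))) lambda = k.+1 by [].
rewrite /cnt (eq_bigr (fun=> 1%N)) ?sum_nat_const ?card_ord ?muln1// => i _.
case: (unliftP ord0 i) => [j ->|->]; last by rewrite /= ltW.
by rewrite tnthS; have := By j; rewrite /= in_itv/= => ->.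
Qed.

End completeness.

Lemma ae_forall_count {d} {T : measurableType d} {R : realType}
    (mu : {measure set T -> \bar R}) (I : countType) (A : I -> T -> Prop) :
  (forall i, {ae mu, forall x, A i x}) -> {ae mu, forall x, forall i, A i x}.
Proof.
move=> aeA; pose B (m : nat) x := forall i, pickle i = m -> A i x.
have aeB m : {ae mu, forall x, B m x}.
  case E : (@unpickle I m) => [i|].
    apply: filterS (aeA i) => x Aix j jm.
    by have := pickleK j; rewrite jm E => -[<-].
  by apply: aeW => x j jm; have := pickleK j; rewrite jm E.
by apply: filterS (ae_foralln aeB) => x Bx i; exact: (Bx (pickle i)).
Qed.

(** * Transfer of null sets to arbitrary models *)

Section transfer.
Context {R : realType} {k : nat}.
Variable M : BI_model R k.+1.
Hypothesis C1M : C1 M.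
Local Notation n := k.+1.
Local Notation P := (bi_P M).
Local Notation nu := (power (unif01 R) k).

Let X (i : 'I_n) (h : {ffun 'I_k -> bool}) (j : 'I_k) : bi_T M -> R :=
  if h j then bi_xi M (lift i j) else bi_U M (lift i j).

(** Each constraint falls on U or on xi according to [h], so the event is a box for the U's
    intersected with a box for the xi's in which H is unconstrained. Independence of U from (H, xi)
    separates the two boxes, and independence within each family finishes. *)
Let X_independent i h (A : 'I_k -> set R) : (forall j, measurable (A j)) ->
  P (\bigcap_(j in [set: 'I_k]) X i h j @^-1` A j) =
  (\prod_(j < k) P (X i h j @^-1` A j))%E.
Proof.
move=> mA; pose AU m := if unlift i m is Some j then
  if h j then setT else A j else setT.
pose Ax m := if unlift i m is Some j then
  if h j then A j else setT else setT.
have mAU m : measurable (AU m).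
  by rewrite /AU; case: unlift => // j; case: ifP.
have mAx m : measurable (Ax m).
  by rewrite /Ax; case: unlift => // j; case: ifP.
pose Ux := (fun w => [tuple bi_U M m w | m < n]) @^-1` rect AU.
pose xx := (fun w => [tuple (bi_H M m w, bi_xi M m w) | m < n]) @^-1`
  rect (fun m => setT `*` Ax m).
have UxE : Ux = \bigcap_(m in [set` [set: 'I_n]%SET]) bi_U M m @^-1` AU m.
  rewrite /Ux preimage_mktuple_rect; apply/seteqP; split=> w Uw m _; first exact: Uw.
  by apply: Uw; rewrite /= inE.
have xxE : xx = \bigcap_(m in [set` [set: 'I_n]%SET]) bi_xi M m @^-1` Ax m.
  rewrite /xx preimage_mktuple_rect; apply/seteqP; split=> w /= xw m _.
    by have [] := xw m Logic.I.
  by split=> //; apply: xw; rewrite /= inE.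
rewrite (_ : \bigcap_(j in _) _ = Ux `&` xx); last first.
  rewrite UxE xxE; apply/seteqP; split=> w.
    move=> Xw; split=> m _ /=; rewrite /AU /Ax; case: unliftP => // j ->;
      by have := Xw j Logic.I; rewrite /X /=; case: (h j).
  move=> [Uw xw] j _ /=.
  have lU : [set` [set: 'I_n]%SET] (lift i j) by rewrite /= inE.
  have := Uw _ lU; have := xw _ lU; rewrite /= /AU /Ax liftK /X.
  by case: (h j).
rewrite (@bi_indep_Hxi _ _ M); last 2 first.
- exact: measurable_rect.
- by apply: measurable_rect => m; exact: measurableX.
rewrite -/Ux -/xx UxE xxE (@bi_U_indep _ _ M) // (proj1 C1M)//.
rewrite -big_split/= (bigD1_ord i) ?inE//= /AU /Ax unlift_none !preimage_setT.
rewrite !probability_setT !mul1e; apply: eq_big => [j|j _]; first by rewrite inE.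
by rewrite liftK /X; case: (h j); rewrite preimage_setT probability_setT ?mul1e ?mule1.
Qed.

(* [H] may depend on [xi], but the p-values outside [i] form one of the [2 ^ k]
   random vectors obtained by freezing [H], each of which has a density. *)
Lemma pval_tail_null (Nul : set (k.-tuple R)) (i : 'I_n) :
  measurable Nul -> nu Nul = 0%E ->
  {ae P, forall w, ~ Nul [tuple Defs.pval w (lift i j) | j < k]}.
Proof.
move=> mNul Nul0.
have [_ [f1 [mf1 f10 f1E _]]] := C1M.
have mX h j : measurable_fun setT (X i h j).
  by rewrite /X; case: (h j); exact: measurable_funPT.
have null h : P ((fun w => [tuple X i h j w | j < k]) @^-1` Nul) = 0%E.
  apply: (independent_densities_null (mu := unif01 R)
    (f := fun j => if h j then EFin \o f1 else cst 1%E)) => //.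
  - move=> j; case: ifP => _; first exact/measurable_EFinP.
    exact: measurable_cst.
  - by move=> j x; case: ifP => _ //=; rewrite lee_fin.
  - move=> j A mA; rewrite /X; case: ifP => _.
      (* The density [f1] refers to Lebesgue measure on the whole line, [mu] to [0, 1]; the two
         agree because xi takes its values in [0, 1]. *)
      rewrite integral_mkcond ge0_integral_uniform0//; last 2 first.
      - apply/(measurable_restrictT _ mA); apply: measurable_funTS.
        exact/measurable_EFinP.
      - by move=> x; apply: erestrict_ge0 => y _; rewrite lee_fin.
      rewrite invr1 mul1e -integral_mkcondr -(f1E (lift i j)); last first.
        by apply: measurableI => //; exact: measurable_itv.
      congr (P _); apply/seteqP; split=> w /=; last by case.
      by split=> //; rewrite in_itv/=; exact: bi_xi01.
    rewrite integral_cst// mul1e; exact: bi_U_unif.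
  - by move=> A mA; exact: X_independent.
have nullX h : {ae P, forall w, ~ Nul [tuple X i h j w | j < k]}.
  exists ((fun w => [tuple X i h j w | j < k]) @^-1` Nul); split => //.
    rewrite -[X in measurable X]setTI; exact: (measurable_mktuple (mX h)).
  by move=> w /= /contrapT.
have := ae_forall_count nullX.
apply: filterS => w Xw; have := Xw [ffun j => bi_H M (lift i j) w].
congr (~ Nul _); apply: eq_from_tnth => j; rewrite !tnth_mktuple.
rewrite /X ffunE /Defs.pval; case: (bi_H M _ w) => /=.
  by rewrite subrr mul0r add0r mul1r.
by rewrite subr0 mul1r mul0r addr0.
Qed.

(** Any p-value at most [lambda] can play the part of the null moved to 0, as this changes no count
    at a level above [lambda] or equal to it. Hence min(b, lambda / C) = c at almost every outcome
    with C > 0, where b is the realized slope and C the number of p-values at most [lambda]; the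
    rest is solving for b. *)
Lemma crit_eq_of_cond_share (alpha0 lambda : R) (n0hat : (R -> R) -> R) (c : R) :
  0 < alpha0 -> 0 < lambda -> lambda < 1 -> (forall f, 0 < n0hat f) ->
  tail_measurable lambda n0hat -> 0 < c ->
  nu [set y | cond_share alpha0 lambda n0hat y != c] = 0%E ->
  crit_eq_as alpha0 lambda n0hat (n%:R * c) M.
Proof.
move=> alpha00 lambda0 lambda1 n00 mn0 c0 null.
set Nul := [set y | _] in null.
have mNul : measurable Nul.
  rewrite (_ : Nul = setT `&` cond_share alpha0 lambda n0hat @^-1` (~` [set c])).
    by apply: measurable_cond_share => //; apply: measurableC.
  by rewrite setTI; apply/seteqP; split=> y /= /eqP.
have cn : c <= lambda / n%:R.
  by apply: (cond_share_le_size (alpha0 := alpha0) (n0hat := n0hat)).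
have n0 : 0 < n%:R :> R by rewrite ltr0n.
(* The index [m] chosen below depends on the outcome, so the null sets of all indices are united
   beforehand. *)
have := ae_forall_count (fun i => pval_tail_null i mNul null).
apply: filterS => w tail i /andP[i1 iN] pos cases.
set q := Defs.pval w.
pose C := cnt q lambda; pose b := slope alpha0 n0hat q.
have C0 : (0 < C)%N.
  by move: pos; rewrite ecdfE pmulr_rgt0 ?invr_gt0// ltr0n.
have [m qm] : exists m, q m <= lambda.
  apply: contrapT => nq; move: C0; rewrite /C /cnt big1// => j _.
  by case: leP => // qj; case: nq; exists j.
set y := [tuple q (lift m j) | j < k].
have cnty s : lambda <= s -> cnt q s = cnt (tnth (ucons (0 : R, y))) s.
  move=> ls; rewrite /cnt (bigD1_ord m)// big_ord_recl/=.
  rewrite (le_trans qm ls) (le_trans (ltW lambda0) ls); congr addn.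
  by apply: eq_bigr => j _; rewrite tnthS tnth_mktuple.
have cE : Num.min b (lambda / C%:R) = c.
  have /negP := tail m; rewrite negbK -/q -/y => /eqP.
  rewrite /cond_share -(cnty _ (lexx _)) -/C => <-; congr Num.min.
  exact: (eq_slope_tail _ mn0).
have CR : 0 < C%:R :> R by rewrite ltr0n.
have lamC : c < lambda / C%:R -> b = c.
  by move=> cl; move: cE; rewrite minEle; case: ifP => // _ lc; rewrite lc ltxx in cl.
have nc : n%:R * c <= lambda by rewrite mulrC -ler_pdivlMr.
have ic j : (j <= n)%N -> j%:R * c <= lambda.
  by move=> jn; apply: le_trans nc; rewrite ler_wpM2r ?ler_nat// ltW.
rewrite adaptive_critE -/b [RHS](_ : _ = i%:R * c); last first.
  by field; rewrite gt_eqF.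
have linear : b = c -> Num.min (i%:R * b) lambda = i%:R * c.
  by move=> ->; rewrite min_l// ic.
case: cases => [Clt|lt_lambda|in_].
(* Here C < n, so c <= lambda / n < lambda / C. *)
- apply/linear/lamC/(le_lt_trans cn).
  rewrite ltr_pM2l// ltf_pV2 ?posrE// ltr_nat.
  by move: Clt; rewrite ecdfE mulrC ltr_pdivrMr// mul1r ltr_nat.
(* Here C c <= n c < lambda. *)
- apply/linear/lamC; rewrite ltr_pdivlMr//; apply: le_lt_trans lt_lambda.
  rewrite mulrC; apply: ler_wpM2r; first exact: ltW.
  by rewrite ler_nat cnt_le_size.
(* If b > c, then lambda = C c <= n c <= lambda, so lambda = n c and the n-th critical value equals
   its cap, which is the claimed value although b is not determined. *)
- have [cb|bc] := ltP c b; last first.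
    apply: linear; apply/eqP; rewrite eq_le bc/= -cE ge_min lexx//.
  have lc : lambda / C%:R = c.
    by move: cE; rewrite minElt; case: ifP => // _ bc; rewrite bc ltxx in cb.
  have nl : n%:R * c = lambda.
    apply/eqP; rewrite eq_le nc/=.
    have -> : lambda = C%:R * c by rewrite -lc mulrC divfK// gt_eqF.
    apply: ler_wpM2r; first exact: ltW.
    by rewrite ler_nat cnt_le_size.
  rewrite in_ min_r ?nl// -nl; apply: ler_wpM2l; first exact: ltW.
  exact: ltW.
Qed.

End transfer.

(** * Extracting the mean share from the FDR hypothesis *)

Section witnesses.
Context {R : realType} {k : nat}.
Variables (p : R) (N : nat) (t : nat -> R) (e0 e1 : bool -> bool).
Hypotheses (p01 : 0 <= p <= 1) (t0 : forall i, 0 < t i).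
Local Notation n := k.+1.

Lemma mdl_H_false (i : 'I_n) :
  (power (base p N t0) n (mdl_H e0 e1 i @^-1` [set false]) =
   (flag_mass p (null_flag e0 e1 i))%:E)%E.
Proof.
rewrite -(integral_flag N p01 t0).
have mf : measurable_fun setT (fun x : R * (bool * R) => null_flag e0 e1 i x.2.1).
  by apply: (@measurableT_comp _ _ _ _ _ _ (null_flag e0 e1 i)) => //;
    exact: measurableT_comp.
rewrite (_ : mdl_H e0 e1 i @^-1` [set false] =
  (@tnth n _ ^~ i) @^-1` ((fun x => null_flag e0 e1 i x.2.1) @^-1` [set false]))//.
have mA : measurable
    ((fun x : R * (bool * R) => null_flag e0 e1 i x.2.1) @^-1` [set false]).
  by rewrite -[X in measurable X]setTI; exact: mf.
rewrite power_coordinate// -[X in base _ _ _ X]setIT -integral_indic//.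
apply: eq_integral => x _; rewrite indicE; congr ((nat_of_bool _)%:R%:E).
apply/idP/idP; first by rewrite inE /= => ->.
by rewrite inE /=; case: null_flag.
Qed.

Lemma mean_share_of_FDR (alpha0 lambda : R) (n0hat : (R -> R) -> R)
    (EN0_gt0 : 0 < @mdl_EN0 R k p e0 e1) (c : R) :
  (forall i, t i <= 1) ->
  0 < alpha0 -> 0 < lambda -> lambda < 1 -> (forall f, 0 < n0hat f) ->
  tail_measurable lambda n0hat ->
  e1 true -> e1 false = false \/ p = 1 -> e0 =1 e1 \/ (forall b, e1 b) ->
  let M := mdl N p01 t0 EN0_gt0 in
  FDR (adaptive_crit alpha0 lambda n0hat) M =
    ('E_(bi_P M)[fun w => (N0 w)%:R] * c%:E)%E ->
  @mean_share R k p N t alpha0 lambda n0hat = c%:E.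
Proof.
move=> t1 alpha00 lambda0 lambda1 n00 mn0 e1t e1f e01 /=.
rewrite FDR_mdl// [X in (X * _)%E = _ -> _]/=.
have -> : ('E_(power (base p N t0) n)[fun w => (N0 (M := mdl N p01 t0 EN0_gt0) w)%:R] =
    (@mdl_EN0 R k p e0 e1)%:E)%E by exact: mdl_EN0E.
move=> H.
have /(congr1 (fun x => (((@mdl_EN0 R k p e0 e1)^-1)%:E * x)%E)) := H.
by rewrite !muleA -EFinM mulVf ?mul1e// gt_eqF.
Qed.

End witnesses.

Theorem theorem11 (R : realType) (n : nat) (hn : (0 < n)%N)
    (alpha0 lambda : R)
    (halpha0 : 0 < alpha0) (hal : alpha0 < lambda) (hlambda : lambda < 1)
    (n0hat : (R -> R) -> R)
    (hn0_gt0 : forall f, 0 < n0hat f)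
    (hn0_meas : tail_measurable lambda n0hat) :
  (forall (Pi0 : set R) (I : interval R) (c : R),
     [set` I] `<=` `]0, 1[ -> interior [set` I] !=set0 ->
     [set` I] `<=` Pi0 ->
     0 < c < n%:R^-1 ->
     (forall M : BI_model R n, C1 M -> C2 Pi0 M ->
        FDR (adaptive_crit alpha0 lambda n0hat) M =
        ('E_(bi_P M)[fun w => (N0 w)%:R] * c%:E)%E) ->
     forall M : BI_model R n, C1 M -> C2 Pi0 M ->
       crit_eq_as alpha0 lambda n0hat (n%:R * c) M)
  /\
  (forall c : R,
     0 < c < n%:R^-1 ->
     (forall M : BI_model R n, C1 M -> fixed_N0_1 M ->
        FDR (adaptive_crit alpha0 lambda n0hat) M =
        ('E_(bi_P M)[fun w => (N0 w)%:R] * c%:E)%E) ->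
     forall M : BI_model R n, C1 M -> fixed_N0_1 M ->
       crit_eq_as alpha0 lambda n0hat (n%:R * c) M).
Proof.
case: n hn => // k _; have lambda0 := lt_trans halpha0 hal.
split=> [Pi0 I c I01 [pi0 /interior_subset Ipi0] IPi0|c] /andP[c0 _] FDRc M C1M _.
  have := I01 _ Ipi0; rewrite /= in_itv/= => /andP[pi0_gt0 pi0_lt1].
  apply: crit_eq_of_cond_share => //.
  (* The Bernoulli parameter is the probability of H = 1, hence 1 - pi0; it is positive, as the
     division by pi1 in the polarization requires. *)
  have p01 : 0 <= 1 - pi0 <= 1 by lra.
  have flagE : flag_mass (1 - pi0) id = pi0 by rewrite /flag_mass /=; ring.
  have flagi (i : 'I_k.+1) : null_flag id id i = id by rewrite /null_flag; case: ifP.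
  have EN0_gt0 : 0 < @mdl_EN0 R k (1 - pi0) id id.
    rewrite /mdl_EN0 (eq_bigr (fun=> pi0)) => [|i _]; last by rewrite flagi.
    by rewrite sumr_const card_ord -mulr_natl mulr_gt0.
  apply: (cond_share_eq_ae _ _ _ _ _ (p := 1 - pi0)) => //; [lra|exact: ltW|].
  move=> N t t0 t1.
  apply: (mean_share_of_FDR (p01 := p01) (t0 := t0) (EN0_gt0 := EN0_gt0)) => //.
  - by left.
  - by left.
  - apply: FDRc; first exact: mdl_C1.
    split.
    + exact: mdl_H_indep.
    + exists pi0; first exact: IPi0.
      by move=> i; rewrite -[in RHS]flagE -[id in RHS](flagi i); exact: mdl_H_false.
    + exact: mdl_H_xi_indep.
apply: crit_eq_of_cond_share => //.
(* Hypothesis [ord0] is always true and the others are always false, so N_0 = 1 at every outcome.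
   With p = 1, [base_pdf] reduces to the mixture density. *)
pose e0 (b : bool) := false; pose e1 (b : bool) := true.
have p01 : (0 : R) <= (1 : R) <= 1 by rewrite ler01 lexx.
have EN0_gt0 : 0 < @mdl_EN0 R k 1 e0 e1.
  rewrite /mdl_EN0 big_ord_recl ltr_pwDl//.
    by rewrite /flag_mass /= subrr; lra.
  by apply: sumr_ge0 => i _; exact: flag_mass_ge0.
apply: (cond_share_eq_ae _ _ _ _ _ (p := 1)) => //; [lra|exact: ltW|].
move=> N t t0 t1.
apply: (mean_share_of_FDR (p01 := p01) (t0 := t0) (EN0_gt0 := EN0_gt0)) => //.
- by right.
- by right.
- apply: FDRc; first exact: mdl_C1.
  apply: aeW => w; rewrite /N0 big_ord_recl big1 ?addn0//=.
Qed.
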